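(* Let $\beta\neq\gamma$ in $\mathbb{D}$ and $\theta\in(0,1)\setminus\mathbb{Q}$, and let $\Sigma = \sigma(\mathcal{E}_{\omega_0})$. Define $$B = \{\zeta\in\mathbb{C}\setminus\{0\} : (\mathrm{tr}(M_n(\zeta)))_{n} \text{ is a bounded sequence in } \mathbb{C}\},$$ $$B' = \{\zeta\in\mathbb{C}\setminus\{0\} : (x_n(\zeta),y_n(\zeta),z_n(\zeta))_{n\ge 0}\text{ is a bounded sequence in }\mathbb{C}^3\}.$$ Then $B'=\Sigma=B$.
   Context: $\mathbb{D} = \{z \in \mathbb{C} : |z|<1\}$. Given $\alpha = (\alpha_n)_{n\in\mathbb{Z}}$ with $\alpha_n \in \mathbb{D}$ (the Verblunsky coefficients), the corresponding extended CMV matrix is the unitary operator $\mathcal{E} = \mathcal{L}\mathcal{M}$ on $\ell^2(\mathbb{Z})$, where $$\mathcal{L} = \bigoplus_{j\in\mathbb{Z}} \Theta(\alpha_{2j}),\quad \mathcal{M} = \bigoplus_{j\in\mathbb{Z}} \Theta(\alpha_{2j+1}),\quad \Theta(\alpha) = \begin{pmatrix} \overline{\alpha} & \rho_\alpha \\ \rho_\alpha & -\alpha\end{pmatrix},\quad \rho_\alpha = \sqrt{1-|\alpha|^2},$$ and $\Theta(\alpha_n)$ acts on $\ell^2(\{n,n+1\})$. Let $\omega_0 = s_{\theta,\theta}\in\{0,1\}^{\mathbb{Z}}$, i.e. $\omega_0(n) = \lfloor (n+1)\theta+\theta\rfloor-\lfloor n\theta+\theta\rfloor$, and let $\mathcal{E}_{\omega_0}$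 be the extended CMV matrix with Verblunsky coefficients $\alpha_{\omega_0}(n) = \beta$ if $\omega_0(n)=0$ and $\alpha_{\omega_0}(n)=\gamma$ if $\omega_0(n)=1$. Write $\theta = [a_1,a_2,\dots]$ for the continued fraction expansion of $\theta$ with positive integers $a_j$, and let $q_0=1$, $q_1=a_1$, $q_n = a_nq_{n-1}+q_{n-2}$ for $n\ge2$. Let $$S(\alpha,\zeta) = \frac{1}{\rho_\alpha}\begin{pmatrix}\zeta & -\overline{\alpha}\\ -\alpha\zeta & 1\end{pmatrix},\qquad T_{\omega_0}(n,0;\zeta) = S(\alpha_{\omega_0}(n-1),\zeta)\cdots S(\alpha_{\omega_0}(0),\zeta)\ (n\ge1).$$ For $\zeta\in\mathbb{C}\setminus\{0\}$ define $M_{-1}(\zeta) = S(\gamma,\zeta)S(\beta,\zeta)^{-1}$, $M_0(\zeta) = \zeta^{-1/2}S(\beta,\zeta)$, and $M_n(\zeta) = \zeta^{-q_n/2}\,T_{\omega_0}(q_n,0;\zeta)$ for $n\ge1$, where a square root $\zeta^{-1/2}$ of $\zeta^{-1}$ is fixed and $\zeta^{-q_n/2} = (\zeta^{-1/2})^{q_n}$ (so $\zeta^{-q_n/2} = \zeta^{-a_nq_{n-1}/2}\zeta^{-q_{n-2}/2}$ for $n\ge2$). For $n\ge0$ set $x_n = \tfrac12\mathrm{tr}(M_{n-1})$, $y_n=\tfrac12\mathrm{tr}(M_n)$, $z_n = \tfrac12\mathrm{tr}(M_nM_{n-1})$. In the definition of $B$, $n$ ranges over $n\ge-1$. *)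

(* Defs.v *)
From HB Require Import structures.
From mathcomp Require Import all_boot all_order all_algebra.
From mathcomp Require Import all_classical all_reals all_analysis.
From mathcomp Require Import complex ring lra.
Import Order.TTheory GRing.Theory Num.Theory.
Import numFieldNormedType.Exports.
Import Normc.

Set Implicit Arguments.
Unset Strict Implicit.
Unset Printing Implicit Defensive.

Local Open Scope classical_set_scope.
Local Open Scope ring_scope.

Definition ell2_pred (R : realType) : pred (int -> R[i]) :=
  fun f => `[< summable [set: int] (fun n => (normc (f n) ^+ 2)%:E) >].
Arguments ell2_pred : clear implicits.

Section ell2_closed.
Variable R : realType.
Implicit Types (x y : R[i]) (f g : int -> R[i]) (a b : int -> R).

Let fins a := (\esum_(n in [set: int]) (a n)%:E < +oo)%E.

Lemma normc_ge0 x : 0 <= normc x.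
Proof. by case: x => a b; rewrite /= sqrtr_ge0. Qed.

Lemma sqr_normcD x y :
  normc (x + y) ^+ 2 <= 2 * normc x ^+ 2 + 2 * normc y ^+ 2.
Proof.
have := le_normcD x y; have := normc_ge0 (x + y).
have := normc_ge0 x; have := normc_ge0 y.
move: (normc (x + y)) (normc x) (normc y) => s u v v0 u0 s0 h.
have h2 : s ^+ 2 <= (u + v) ^+ 2 by rewrite ler_sqr ?nnegrE// addr_ge0.
have := sqr_ge0 (u - v); rewrite !expr2 in h2 *; nra.
Qed.

Lemma ell2P f : reflect (fins (fun n => normc (f n) ^+ 2)) (f \in ell2_pred R).
Proof.
have e : (\esum_(n in [set: int]) (normc (f n) ^+ 2)%:E =
         \esum_(n in [set: int]) `|(normc (f n) ^+ 2)%:E|)%E.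
  by apply: eq_esum => n _; rewrite gee0_abs// lee_fin sqr_ge0.
by rewrite /fins e; apply: asboolP.
Qed.

Let fins_le a b : (forall n, a n <= b n) -> fins b -> fins a.
Proof.
by move=> ab; apply: le_lt_trans; apply: le_esum => n _; rewrite lee_fin.
Qed.

Let finsD a b : (forall n, 0 <= a n) -> (forall n, 0 <= b n) ->
  fins a -> fins b -> fins (fun n => a n + b n).
Proof.
move=> a0 b0 fa fb; rewrite /fins.
under eq_esum do rewrite EFinD.
by rewrite esumD ?lte_add_pinfty// => n _; rewrite lee_fin.
Qed.

Let finsZ (c : R) a : (forall n, 0 <= a n) -> fins a -> fins (fun n => c * a n).
Proof.
move=> a0 fa.
apply: (@fins_le _ (fun n => (Num.bound c)%:R * a n)) => [n|].
  apply: ler_wpM2r => //.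
  apply: le_trans (ler_norm c) _; apply/ltW.
  by have := archi_boundP (normr_ge0 c); rewrite /Num.bound normr_id.
elim: (Num.bound c) => [|k IH].
  by rewrite /fins esum1// => n _; rewrite mul0r.
apply: (@fins_le _ (fun n => k%:R * a n + a n)) => [n|].
  by rewrite -natr1 mulrDl mul1r.
by apply: finsD => // n; rewrite mulr_ge0 ?ler0n//.
Qed.

Let fins_shift (k : int) a : fins a -> fins (fun n => a (n + k)).
Proof.
rewrite /fins (@reindex_esum R _ _ [set: int] [set: int] (fun n => n + k))//.
split=> //=; first by move=> x y _ _ /addIr.
by move=> n _; exists (n - k) => //; rewrite subrK.
Qed.

Lemma ell2_submod_closed : submod_closed (ell2_pred R).
Proof.
split.
  by apply/ell2P; rewrite /fins esum1// => n _; rewrite normc0 expr0n.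
move=> c f g /ell2P hf /ell2P hg; apply/ell2P.
apply: (@fins_le _ (fun n => (2 * normc c ^+ 2) * normc (f n) ^+ 2
                              + 2 * normc (g n) ^+ 2)) => [n|].
  have /= := sqr_normcD (c * f n) (g n).
  by rewrite normcM exprMn mulrA.
have sq0 (h : int -> R[i]) n : 0 <= normc (h n) ^+ 2 by exact: sqr_ge0.
have c2 : 0 <= 2 * normc c ^+ 2 by rewrite mulr_ge0 ?sqr_ge0.
apply: finsD => [n|n||].
- by rewrite mulr_ge0 ?ler0n//.
- by rewrite mulr_ge0 ?ler0n//.
- exact: (finsZ _ (sq0 f)).
- exact: (finsZ _ (sq0 g)).
Qed.

Lemma ell2_tridiag (f h c0 c1 c2 : int -> R[i]) :
  (forall n, normc (c0 n) <= 1) -> (forall n, normc (c1 n) <= 1) ->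
  (forall n, normc (c2 n) <= 1) ->
  (forall n, h n = c0 n * f (n - 1) + c1 n * f n + c2 n * f (n + 1)) ->
  f \in ell2_pred R -> h \in ell2_pred R.
Proof.
move=> b0 b1 b2 hE /ell2P hf; apply/ell2P.
have le1 x y : normc x <= 1 -> normc (x * y) ^+ 2 <= normc y ^+ 2.
  move=> x1; rewrite normcM exprMn ler_piMl ?sqr_ge0//.
  by rewrite expr_le1 ?normc_ge0.
apply: (@fins_le _ (fun n => 4 * (normc (f (n - 1)) ^+ 2)
   + (4 * (normc (f n) ^+ 2) + 2 * normc (f (n + 1)) ^+ 2))) => [n|].
  rewrite hE.
  have := sqr_normcD (c0 n * f (n - 1) + c1 n * f n) (c2 n * f (n + 1)).
  have := sqr_normcD (c0 n * f (n - 1)) (c1 n * f n).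
  have := le1 _ (f (n - 1)) (b0 n); have := le1 _ (f n) (b1 n).
  have := le1 _ (f (n + 1)) (b2 n); lra.
have sq0 (g : int -> R[i]) n : 0 <= normc (g n) ^+ 2 by exact: sqr_ge0.
apply: finsD => [n|n||].
- by rewrite mulr_ge0 ?ler0n//.
- by rewrite addr_ge0// mulr_ge0 ?ler0n//.
- apply: finsZ => [n|]; first exact: sqr_ge0.
  exact: (@fins_shift (-1) (fun n => normc (f n) ^+ 2)).
apply: finsD => [n|n||].
- by rewrite mulr_ge0 ?ler0n//.
- by rewrite mulr_ge0 ?ler0n//.
- exact: (finsZ _ (sq0 f)).
- apply: finsZ => [n|]; first exact: sqr_ge0.
  exact: (@fins_shift 1 (fun n => normc (f n) ^+ 2)).
Qed.

HB.instance Definition _ :=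
  GRing.isSubmodClosed.Build R[i] (int -> R[i]) (ell2_pred R)
    ell2_submod_closed.

End ell2_closed.

Record ell2 (R : realType) :=
  Ell2 { ell2_fun :> int -> R[i]; ell2_funP : ell2_fun \in ell2_pred R }.

Section ell2_lmod.
Variable R : realType.
HB.instance Definition _ := [isSub for @ell2_fun R].
HB.instance Definition _ := [Choice of ell2 R by <:].
HB.instance Definition _ := [SubChoice_isSubLmodule of ell2 R by <:].
End ell2_lmod.

Definition ell2_norm (R : realType) (f : ell2 R) : R :=
  Num.sqrt (fine (\esum_(n in [set: int]) (normc (f n) ^+ 2)%:E)).

Definition bounded_operator (R : realType) (T : ell2 R -> ell2 R) : Prop :=
  exists K : R, forall f, ell2_norm (T f) <= K * ell2_norm f.

Definition spectrum (R : realType) (T : {linear ell2 R -> ell2 R}) : set R[i] :=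
  [set z | ~ exists S : {linear ell2 R -> ell2 R},
    [/\ bounded_operator S,
        forall f, S (T f - z *: f) = f &
        forall f, T (S f) - z *: S f = f]].

Definition disk (R : realType) := {a : R[i] | normc a < 1}.

Definition rho (R : realType) (a : R[i]) : R[i] :=
  real_complex R (Num.sqrt (1 - normc a ^+ 2)).

Definition mx22 (A : Type) (a b c d : A) : 'M[A]_2 :=
  \matrix_(i < 2, j < 2)
    if i == 0 then (if j == 0 then a else b) else (if j == 0 then c else d).

Definition Theta (R : realType) (a : R[i]) : 'M[R[i]]_2 :=
  mx22 (conjc a) (rho a) (rho a) (- a).

(* The action of the direct sum of the Theta (alpha n), over the n whose
   parity is p, each acting on span(delta_n, delta_(n+1)) *)
Definition Theta_sum_fun (R : realType) (p : bool) (alpha : int -> disk R)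
    (f : int -> R[i]) : int -> R[i] := fun n =>
  if odd `|n|%N == p
  then Theta (val (alpha n)) 0 0 * f n + Theta (val (alpha n)) 0 1 * f (n + 1)
  else Theta (val (alpha (n - 1))) 1 0 * f (n - 1)
       + Theta (val (alpha (n - 1))) 1 1 * f n.

Section Theta_sum.
Variables (R : realType) (p : bool) (alpha : int -> disk R).

Lemma normc_rho_le1 (a : R[i]) : normc (rho a) <= 1.
Proof.
rewrite /rho /= expr0n addr0 sqrtr_sqr ger0_norm ?sqrtr_ge0//.
rewrite -[leRHS]sqrtr1 ler_sqrt// gerBl; exact: sqr_ge0.
Qed.

Lemma normc_Theta_le1 (a : disk R) i j : normc (Theta (val a) i j) <= 1.
Proof.
have a1 : normc (val a) <= 1 by apply/ltW; exact: (valP a).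
rewrite /Theta !mxE; case: ifP => _; case: ifP => _; try exact: normc_rho_le1.
  by move: a1; case: (val a) => x y /=; rewrite sqrrN.
by rewrite normcN.
Qed.

Lemma Theta_sum_ell2 (f : ell2 R) :
  Theta_sum_fun p alpha f \in ell2_pred R.
Proof.
pose b n := odd `|n|%N == p.
pose c0 n := if b n then 0 else Theta (val (alpha (n - 1))) 1 0.
pose c1 n := if b n then Theta (val (alpha n)) 0 0
             else Theta (val (alpha (n - 1))) 1 1.
pose c2 n := if b n then Theta (val (alpha n)) 0 1 else 0.
apply: (@ell2_tridiag R f _ c0 c1 c2); last exact: ell2_funP.
- by move=> n; rewrite /c0; case: ifP => _; rewrite ?normc0 ?normc_Theta_le1.
- by move=> n; rewrite /c1; case: ifP => _; rewrite normc_Theta_le1.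
- by move=> n; rewrite /c2; case: ifP => _; rewrite ?normc0 ?normc_Theta_le1.
- move=> n; rewrite /Theta_sum_fun /c0 /c1 /c2 /b.
  by case: ifP => _; rewrite mul0r ?add0r ?addr0.
Qed.

Definition Theta_sum (f : ell2 R) : ell2 R := Ell2 (Theta_sum_ell2 f).

Lemma Theta_sum_is_linear : linear Theta_sum.
Proof.
move=> c f g; apply/val_inj/funext => n.
have E (u v : ell2 R) m : (c *: u + v) m = c * u m + v m by [].
change (Theta_sum_fun p alpha (c *: f + g : ell2 R) n =
  c * Theta_sum_fun p alpha f n + Theta_sum_fun p alpha g n).
rewrite /Theta_sum_fun !E.
by case: ifP => _; ring.
Qed.

HB.instance Definition _ :=
  GRing.isLinear.Build R[i] (ell2 R) (ell2 R) *:%R Theta_sum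
    Theta_sum_is_linear.

End Theta_sum.

Definition extended_CMV (R : realType) (alpha : int -> disk R) :
    {linear ell2 R -> ell2 R} :=
  Theta_sum false alpha \o Theta_sum true alpha.

Definition omega0 (R : realType) (theta : R) (n : int) : int :=
  Num.floor ((n + 1)%:~R * theta + theta) - Num.floor (n%:~R * theta + theta).

Definition sturmian_alpha (R : realType) (theta : R) (beta gamma : disk R)
    (n : int) : disk R :=
  if omega0 theta n == 0 then beta else gamma.

(* The partial quotients are a 1, a 2, and so on; a 0 is never used. *)

Fixpoint finite_cf (R : realType) (a : nat -> nat) (n : nat) : R :=
  if n is k.+1 then ((a 1%N)%:R + finite_cf R (fun j => a j.+1) k)^-1 else 0.

Definition is_cf_expansion (R : realType) (a : nat -> nat) (theta : R) : Prop :=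
  (forall j, (0 < j)%N -> (0 < a j)%N) /\ finite_cf R a @ \oo --> theta.

Fixpoint cf_denom (a : nat -> nat) (n : nat) : nat :=
  match n with
  | 0 => 1
  | 1 => a 1
  | (k.+1 as m).+1 => a n * cf_denom a m + cf_denom a k
  end%N.

Definition szego (R : realType) (a zeta : R[i]) : 'M[R[i]]_2 :=
  (rho a)^-1 *: mx22 zeta (- conjc a) (- a * zeta) 1.

Fixpoint transfer (R : realType) (alpha : int -> disk R) (zeta : R[i])
    (n : nat) : 'M[R[i]]_2 :=
  if n is k.+1
  then szego (val (alpha k)) zeta *m transfer alpha zeta k
  else 1%:M.

Section trace_map.
Variables (R : realType) (theta : R) (a : nat -> nat) (beta gamma : disk R).
(* [r] is the chosen square root of [zeta^-1] *)
Variables (r zeta : R[i]).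

(* indexed by [int]: [Negz 0] is the index -1, other negative indices are
   never used *)
Definition M_seq (n : int) : 'M[R[i]]_2 :=
  match n with
  | Negz _ => szego (val gamma) zeta *m invmx (szego (val beta) zeta)
  | Posz 0 => r *: szego (val beta) zeta
  | Posz m => r ^+ cf_denom a m
      *: transfer (sturmian_alpha theta beta gamma) zeta (cf_denom a m)
  end.

Definition x_seq (n : nat) : R[i] := 2^-1 * \tr (M_seq (n%:Z - 1)).
Definition y_seq (n : nat) : R[i] := 2^-1 * \tr (M_seq n%:Z).
Definition z_seq (n : nat) : R[i] :=
  2^-1 * \tr (M_seq n%:Z *m M_seq (n%:Z - 1)).

End trace_map.

Section trace_bounded.
Variables (R : realType) (theta : R) (a : nat -> nat) (beta gamma : disk R).
(* [root zeta] is the chosen square root of [zeta^-1] *)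
Variable root : R[i] -> R[i].

Definition trace_bounded_set : set R[i] :=
  [set zeta | zeta != 0 /\ exists K : R, forall n : int, -1 <= n ->
    normc (\tr (M_seq theta a beta gamma (root zeta) zeta n)) <= K].

Definition trace_map_bounded_set : set R[i] :=
  [set zeta | zeta != 0 /\ exists K : R, forall n : nat,
    [/\ normc (x_seq theta a beta gamma (root zeta) zeta n) <= K,
        normc (y_seq theta a beta gamma (root zeta) zeta n) <= K &
        normc (z_seq theta a beta gamma (root zeta) zeta n) <= K]].

End trace_bounded.

(* Main.v *)
(* The proof goes around B <= Sigma <= B' <= B; the last inclusion is immediate.

   B <= Sigma: words of length q_n are repeated twice at the origin, so bounded
   traces exclude, by Gordon's two-block argument, solutions of E u = zeta u that
   decay at +oo. If E - zeta were invertible, the preimage of a delta function at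
   -1 or -2 would therefore vanish to the right of the origin, whereas on the left
   the flux |u_n|^2 - |(M u)_n|^2 is monotone and tends to 0, which contradicts its
   sign next to the delta function.

   Sigma <= B': E is unitary, so let |zeta| = 1. If the trace orbit at zeta is
   unbounded, it enters a forward invariant open region where all traces exceed 2
   in modulus, and then so do the orbits of all points of the circle within some d
   of zeta. Around the origin the sequence coincides with the rotation coding of
   slope p_n/q_n, n even, whose CMV matrix with period 2 q_n is a finite unitary
   matrix with no eigenvalue within d of zeta. Hence |(E - zeta) f| >= d |f|, and
   two Neumann series, from E to E - lambda zeta with lambda < 1 and from there to
   E - zeta, give the resolvent. *)

Require Import Defs.
From HB Require Import structures.
From mathcomp Require Import all_boot all_order all_algebra.
From mathcomp Require Import all_classical all_reals all_analysis.
From mathcomp Require Import complex zify ring lra.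
Import Order.TTheory GRing.Theory Num.Theory.
Import numFieldNormedType.Exports.
Import Normc.

Set Implicit Arguments.
Unset Strict Implicit.
Unset Printing Implicit Defensive.

Local Open Scope classical_set_scope.
Local Open Scope ring_scope.

(** * Convergents and the coding of the rotation *)

(** [B] lives in the whole punctured plane, so bounded traces must give spectrum off the circle as
    well; hence the two positions of the delta function, one for |zeta| >= 1 and one for |zeta| <=
    1, each making the flux beside it have the forbidden sign. Gordon's argument by itself only
    excludes decaying solutions; a hypothetical resolvent is therefore made to produce one, in l^2,
    with the equation violated at a single negative site. In the other direction the lower bound for
    E - zeta comes from finite matrices whose size grows with n, so d must not depend on n. It does
    not, because escape is an open condition at one index that all later indices inherit. L and M
    couple alternate pairs of sites, so only an even period suits both, whence 2 q_n for q_n of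
    either parity. An eigenvalue of the periodic matrix forces a trace of modulus exactly 2 over q_n
    sites, which escape forbids. The repetition of words falls short by two sites, so the matrix
    recursion is used from index 3 on; finitely many terms do not affect boundedness. *)

Fixpoint cf_num (a : nat -> nat) (n : nat) : nat :=
  match n with
  | 0 => 0
  | 1 => 1
  | (k.+1 as m).+1 => a n * cf_num a m + cf_num a k
  end%N.

(** The free end [x] in place of the final 0 of [finite_cf] allows a partial quotient to be appended
    at the back, where [cf_num] and [cf_denom] recurse, although this recursion peels quotients off
    the front. *)
Fixpoint cf_tail (R : realType) (a : nat -> nat) (n : nat) (x : R) : R :=
  if n is k.+1 then ((a 1%N)%:R + cf_tail (fun j => a j.+1) k x)^-1 else x.

Section continued_fraction.
Variables (R : realType) (a : nat -> nat).
Hypothesis a_gt0 : forall j, (0 < j)%N -> (0 < a j)%N.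

Lemma cf_numSS n : cf_num a n.+2 = (a n.+2 * cf_num a n.+1 + cf_num a n)%N.
Proof. by []. Qed.

Lemma cf_denomSS n :
  cf_denom a n.+2 = (a n.+2 * cf_denom a n.+1 + cf_denom a n)%N.
Proof. by []. Qed.

Lemma cf_denom_gt0 n : (0 < cf_denom a n)%N.
Proof.
elim: n {-2}n (leqnn n) => [|n IH] [|[|m]] //= mn; try exact: a_gt0.
by rewrite addn_gt0 IH ?orbT//; lia.
Qed.

Lemma cf_denom_ltSS n : (cf_denom a n.+1 < cf_denom a n.+2)%N.
Proof.
rewrite cf_denomSS; have := cf_denom_gt0 n; have := a_gt0 (ltn0Sn n.+1).
nia.
Qed.

Lemma cf_denom_ge n : (n <= cf_denom a n)%N.
Proof.
elim: n => // -[_|n IH]; first exact: a_gt0.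
exact: leq_ltn_trans IH (cf_denom_ltSS _).
Qed.

Lemma cf_tail_snoc n (b : nat -> nat) (x : R) :
  cf_tail b n ((b n.+1)%:R + x)^-1 = cf_tail b n.+1 x.
Proof. by elim: n b => // n IH b; rewrite /= IH. Qed.

Lemma finite_cf_tail n (b : nat -> nat) : finite_cf R b n = cf_tail b n 0.
Proof. by elim: n b => // n IH b; rewrite /= IH. Qed.

Lemma cf_tailE n (x : R) : 0 <= x ->
  cf_tail a n.+1 x = ((cf_num a n.+1)%:R + x * (cf_num a n)%:R) /
    ((cf_denom a n.+1)%:R + x * (cf_denom a n)%:R).
Proof.
elim: n x => [|n IH] x x0.
  by rewrite /= mulr1 mulr0 addr0 mul1r.
have a2 : 0 < (a n.+2)%:R + x.
  by rewrite ltr_pwDl// ltr0n; exact: a_gt0.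
rewrite -cf_tail_snoc IH ?invr_ge0 ?ltW//.
rewrite cf_numSS cf_denomSS !natrD !natrM.
have q1 : 0 < (cf_denom a n.+1)%:R :> R by rewrite ltr0n cf_denom_gt0.
have q0 : 0 < (cf_denom a n)%:R :> R by rewrite ltr0n cf_denom_gt0.
move: ((a n.+2)%:R : R) ((cf_denom a n.+1)%:R : R) ((cf_denom a n)%:R : R)
  ((cf_num a n.+1)%:R : R) ((cf_num a n)%:R : R) a2 q1 q0
  => b q' q p' p a2 q1 q0.
by field; rewrite !gt_eqF//; nra.
Qed.

Lemma finite_cfE n : finite_cf R a n = (cf_num a n)%:R / (cf_denom a n)%:R.
Proof.
case: n => [|n]; first by rewrite /= mul0r.
by rewrite finite_cf_tail cf_tailE// !mul0r !addr0.
Qed.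

Lemma cf_det n :
  (cf_num a n.+1)%:R * (cf_denom a n)%:R - (cf_num a n)%:R * (cf_denom a n.+1)%:R
  = (-1) ^+ n :> int.
Proof.
elim: n => [|n IH]; first by rewrite /=; ring.
rewrite cf_numSS cf_denomSS !natrD !natrM exprS -IH; ring.
Qed.

Lemma finite_cf_step n :
  0 < (-1) ^+ n * (finite_cf R a n.+2 - finite_cf R a n).
Proof.
rewrite !finite_cfE.
have q0 : 0 < (cf_denom a n)%:R :> R by rewrite ltr0n cf_denom_gt0.
have q2 : 0 < (cf_denom a n.+2)%:R :> R by rewrite ltr0n cf_denom_gt0.
have -> : (cf_num a n.+2)%:R / (cf_denom a n.+2)%:R
  - (cf_num a n)%:R / (cf_denom a n)%:R
  = (-1) ^+ n * (a n.+2)%:R / ((cf_denom a n.+2)%:R * (cf_denom a n)%:R) :> R.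
  have /(congr1 (fun z : int => z%:~R : R)) := cf_det n.
  rewrite rmorphB !rmorphM !rmorph_nat rmorphXn rmorphN1 => <-.
  rewrite cf_numSS cf_denomSS !natrD !natrM.
  have := q2; rewrite cf_denomSS natrD natrM => q2'.
  by field; rewrite !gt_eqF.
rewrite !mulrA -expr2 sqrr_sign mul1r.
by rewrite divr_gt0 ?mulr_gt0// ltr0n; exact: a_gt0.
Qed.

(** Convergents whose index has the parity of n are strictly monotone, so their limit lies strictly
    beyond the n-th. Passing through index n + 2 keeps the inequality strict. *)
Lemma cf_between (theta : R) n : finite_cf R a @ \oo --> theta ->
  0 < (-1) ^+ n * (theta * (cf_denom a n)%:R - (cf_num a n)%:R).
Proof.
move=> ath; pose e k := (-1) ^+ n * finite_cf R a (n + k.*2).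
have e_incr : {homo e : k m / (k <= m)%N >-> k <= m}.
  apply/nondecreasing_seqP => k; rewrite /e doubleS !addnS -subr_ge0 -mulrBr.
  have := finite_cf_step (n + k.*2).
  by rewrite exprD -mul2n exprM sqrrN !expr1n mulr1 => /ltW.
have cve : e @ \oo --> (-1) ^+ n * theta.
  apply: cvgMl_tmp; apply: cvg_comp ath => P [N _ NP].
  by exists N => // k /= Nk; apply: NP => /=; rewrite -addnn; lia.
have e1 : (-1) ^+ n * finite_cf R a n.+2 <= (-1) ^+ n * theta.
  rewrite -[n.+2]addn2 -/(e 1%N) -(cvg_lim _ cve)//; apply: nondecreasing_cvgn_le => //.
  by apply/cvg_ex; exists ((-1) ^+ n * theta).
have q0 : 0 < (cf_denom a n)%:R :> R by rewrite ltr0n cf_denom_gt0.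
have -> : theta * (cf_denom a n)%:R - (cf_num a n)%:R
    = (theta - finite_cf R a n) * (cf_denom a n)%:R.
  by rewrite finite_cfE; field; rewrite gt_eqF.
rewrite mulrA mulr_gt0//.
have := finite_cf_step n; move: e1; lra.
Qed.

End continued_fraction.

Section rotation_coding.
Variables (R : realType).
Implicit Types (theta x y : R) (m k p q : int).

Lemma eq_floor x y :
  (forall k, (k%:~R <= x) = (k%:~R <= y)) -> Num.floor x = Num.floor y.
Proof.
move=> xy; apply/eqP; rewrite eq_le.
by rewrite !floor_ge_int -xy floor_le xy floor_le.
Qed.

(* [(m + q) theta - p] and [m theta] differ by [theta q - p]; an integer between
   them would write [m] as [q' * i + q * j] with [0 < i] and [0 <= j], so that
   [q' <= m]. *)
Lemma floor_shift theta (s p q p' q' m : int) : s = 1 \/ s = -1 ->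
  0 < q -> 0 < q' -> p' * q - p * q' = s ->
  0 < s%:~R * (theta * q%:~R - p%:~R) ->
  0 < - s%:~R * (theta * q'%:~R - p'%:~R) -> 0 < m < q' ->
  Num.floor ((m + q)%:~R * theta) = Num.floor (m%:~R * theta) + p.
Proof.
move=> s1 q0 q'0 det h h' /andP[m0 mq].
have -> : (m + q)%:~R * theta = (m%:~R * theta + (theta * q%:~R - p%:~R)) + p%:~R.
  by rewrite rmorphD/=; ring.
rewrite floorDrz ?intr_int// intrKfloor; congr (_ + _); apply: eq_floor => k.
have Q0 : 0 < q%:~R :> R by rewrite ltr0z.
have Q'0 : 0 < q'%:~R :> R by rewrite ltr0z.
have M0 : 0 < m%:~R :> R by rewrite ltr0z.
case: s1 det h h' => -> det; rewrite ?rmorphN1 ?opprK !(mul1r, mulN1r) => h h'.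
  apply/idP/idP => [k1|]; last lra.
  rewrite leNgt; apply/negP => k2.
  have i1 : m * p < k * q by rewrite -(ltr_int R) !rmorphM/=; nra.
  have j1 : (k + p) * q' < (m + q) * p'.
    rewrite -(ltr_int R) !rmorphM !rmorphD/=.
    have : (k%:~R + p%:~R) * q'%:~R <= (m%:~R + q%:~R) * (theta * q'%:~R) :> R.
      by rewrite mulrA ler_pM2r//; lra.
    have : (m%:~R + q%:~R) * (theta * q'%:~R) < (m%:~R + q%:~R) * p'%:~R :> R.
      by rewrite ltr_pM2l; lra.
    lra.
  have : m = q * (m * p' - k * q') + q' * (k * q - m * p).
    by transitivity (m * (p' * q - p * q')); [rewrite det; ring | ring].
  have : 0 <= m * p' - k * q' by lia.
  nia.
apply/idP/idP => [|k1]; first lra.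
rewrite leNgt; apply/negP => k2.
have i1 : k * q < m * p by rewrite -(ltr_int R) !rmorphM/=; nra.
have j1 : (m + q) * p' < (k + p) * q'.
  rewrite -(ltr_int R) !rmorphM !rmorphD/=.
  have : (m%:~R + q%:~R) * (theta * q'%:~R) < (k%:~R + p%:~R) * q'%:~R :> R.
    by rewrite mulrA ltr_pM2r//; lra.
  have : (m%:~R + q%:~R) * p'%:~R < (m%:~R + q%:~R) * (theta * q'%:~R) :> R.
    by rewrite ltr_pM2l; lra.
  lra.
have : m = q * (k * q' - m * p') + q' * (m * p - k * q).
  transitivity (m * - (p' * q - p * q')); last by ring.
  by rewrite det opprK mulr1.
have : 0 <= k * q' - m * p' by lia.
nia.
Qed.

(** An integer k with m p / q < k <= m theta would give m = q i + q' j with i = m p' - k q' and j =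
    k q - m p both positive, so that m >= q + q'. *)
Lemma floor_convergent theta p q p' q' m :
  0 < q -> 0 < q' -> p' * q - p * q' = 1 ->
  0 < theta * q%:~R - p%:~R -> 0 < p'%:~R - theta * q'%:~R ->
  0 < m < q + q' ->
  Num.floor (m%:~R * (p%:~R / q%:~R) : R) = Num.floor (m%:~R * theta).
Proof.
move=> q0 q'0 det h h' /andP[m0 mq]; apply: eq_floor => k.
have Q0 : 0 < q%:~R :> R by rewrite ltr0z.
have Q'0 : 0 < q'%:~R :> R by rewrite ltr0z.
have M0 : 0 < m%:~R :> R by rewrite ltr0z.
rewrite mulrA ler_pdivlMr//; apply/idP/idP => k1.
  by rewrite -(ler_pM2r Q0) (le_trans k1)// -mulrA ler_pM2l//; lra.
rewrite leNgt; apply/negP => k2.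
have i1 : m * p < k * q by rewrite -(ltr_int R) !rmorphM.
have j1 : k * q' < m * p' by rewrite -(ltr_int R) !rmorphM/=; nra.
have : m = q * (m * p' - k * q') + q' * (k * q - m * p).
  by transitivity (m * (p' * q - p * q')); [rewrite det; ring | ring].
nia.
Qed.

(** The phase theta moves the floors to m + 1 and m + 2, which are positive for m >= 0; this is the
    origin of the bounds on m + 2 below. *)
Lemma omega0E theta m :
  omega0 theta m = Num.floor ((m + 2)%:~R * theta) - Num.floor ((m + 1)%:~R * theta).
Proof.
have e k : k%:~R * theta + theta = (k + 1)%:~R * theta by rewrite rmorphD/=; ring.
by rewrite /omega0 !e -addrA.
Qed.

End rotation_coding.

Section sturmian_coding.
Variables (R : realType) (theta : R) (a : nat -> nat).
Hypothesis a_cf : is_cf_expansion a theta.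
Let a_gt0 := a_cf.1.
Let q (n : nat) : int := cf_denom a n.
Let p (n : nat) : int := cf_num a n.

Let q_gt0 n : 0 < q n. Proof. exact: cf_denom_gt0. Qed.

Let cfE n : finite_cf R a n = (p n)%:~R / (q n)%:~R.
Proof. exact: finite_cfE. Qed.

Let det n : p n.+1 * q n - p n * q n.+1 = (-1) ^+ n.
Proof. by rewrite -(cf_det a n) !natz. Qed.

Let sgn n : (-1) ^+ n = 1 :> int \/ (-1) ^+ n = -1 :> int.
Proof. by rewrite -signr_odd; case: odd; [right | left]. Qed.

Let between n : 0 < ((-1) ^+ n : int)%:~R * (theta * (q n)%:~R - (p n)%:~R).
Proof. by rewrite rmorphXn rmorphN1; exact: (cf_between a_gt0 n a_cf.2). Qed.

(** Both floors grow by p_n under the shift. The prefix of length q_n + q_(n+1) - 2 thus has period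
    q_n. *)
Lemma omega0_shift n (m : int) : 0 <= m -> m + 2 < (cf_denom a n.+1)%:Z ->
  omega0 theta (m + (cf_denom a n)%:Z) = omega0 theta m.
Proof.
move=> m0 mq; rewrite !omega0E.
have between' : 0 < - ((-1) ^+ n : int)%:~R * (theta * (q n.+1)%:~R - (p n.+1)%:~R).
  by have := between n.+1; rewrite exprS mulN1r rmorphN.
have shift k : 0 < k < q n.+1 ->
    Num.floor ((k + q n)%:~R * theta) = Num.floor (k%:~R * theta) + p n.
  exact: (floor_shift (sgn n) (q_gt0 n) (q_gt0 n.+1) (det n) (between n)).
have -> : m + cf_denom a n + 2 = (m + 2) + q n by rewrite addrAC.
have -> : m + cf_denom a n + 1 = (m + 1) + q n by rewrite addrAC.
rewrite (shift (m + 2)) 1?(shift (m + 1)); [ring | by rewrite /q; lia..].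
Qed.

Lemma omega0_convergent_periodic n (m : int) :
  omega0 (finite_cf R a n) (m + (cf_denom a n)%:Z) = omega0 (finite_cf R a n) m.
Proof.
rewrite !omega0E.
have shift k : Num.floor ((k + q n)%:~R * finite_cf R a n)
    = Num.floor (k%:~R * finite_cf R a n) + p n.
  have -> : (k + q n)%:~R * finite_cf R a n
      = k%:~R * finite_cf R a n + (p n)%:~R.
    rewrite cfE; move: (q n) (p n) (q_gt0 n) => Q P; rewrite -(ltr0z R) => Q0.
    by rewrite rmorphD/=; field; rewrite gt_eqF.
  by rewrite floorDrz ?intr_int// intrKfloor.
have -> : m + cf_denom a n + 2 = (m + 2) + q n by rewrite addrAC.
have -> : m + cf_denom a n + 1 = (m + 1) + q n by rewrite addrAC.
rewrite !shift; ring.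
Qed.

(** An even convergent lies below theta. From above the codings would part early: q_n p_n / q_n is
    the integer p_n, which q_n theta would not reach. *)
Lemma omega0_even_convergent n (m : int) : ~~ odd n -> 0 <= m ->
  m + 2 < (cf_denom a n + cf_denom a n.+1)%N%:Z ->
  omega0 (finite_cf R a n) m = omega0 theta m.
Proof.
move=> evn m0 mq; rewrite !omega0E.
have s1 : (-1) ^+ n = 1 :> int by rewrite -signr_odd (negbTE evn).
have := between n; have := between n.+1.
rewrite exprS s1 mulN1r rmorphN rmorph1 !(mulN1r, mul1r) opprB => b1 b0.
have conv k : 0 < k < q n + q n.+1 -> Num.floor (k%:~R * finite_cf R a n)
    = Num.floor (k%:~R * theta).
  rewrite cfE.
  exact: (floor_convergent (q_gt0 n) (q_gt0 n.+1) (etrans (det n) s1) b0 b1).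
by rewrite !conv//; rewrite /q; lia.
Qed.

(* At [m = 0] both sides vanish; otherwise [m * theta] is not an integer. *)
Lemma floor_convergent_window (L : nat) : irrational theta ->
  \forall n \near \oo, forall m : int, (`|m| <= L)%N ->
    Num.floor (m%:~R * finite_cf R a n) = Num.floor (m%:~R * theta).
Proof.
move=> irr.
have near1 (m : int) : \forall n \near \oo,
    Num.floor (m%:~R * finite_cf R a n) = Num.floor (m%:~R * theta).
  have [->|m0] := eqVneq m 0; first by near=> n; rewrite !mul0r.
  have cv : (fun n => m%:~R * finite_cf R a n) @ \oo --> m%:~R * theta.
    by apply: cvgMl_tmp; exact: a_cf.2.
  have /andP[lo hi] := floor_itv (m%:~R * theta).
  have lo' : (Num.floor (m%:~R * theta))%:~R < m%:~R * theta.
    rewrite lt_neqAle lo andbT; apply/eqP => mth.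
    apply: irr; exists ((Num.floor (m%:~R * theta))%:~R / m%:~R) => //.
    by rewrite fmorph_div !rmorph_int mth mulrC mulKf ?intr_eq0.
  near=> n; apply: floor_def; apply/andP; split.
    by apply/ltW; near: n; exact: (cvgr_gt _ cv).
  by near: n; exact: (cvgr_lt _ cv).
elim: L => [|L IH].
  near=> n => m; rewrite leqn0 absz_eq0 => /eqP ->.
  by rewrite !mul0r.
near=> n.
have inner : forall k : int, (`|k| <= L)%N ->
    Num.floor (k%:~R * finite_cf R a n) = Num.floor (k%:~R * theta).
  by near: n.
have right : Num.floor ((L.+1)%:~R * finite_cf R a n)
    = Num.floor ((L.+1)%:~R * theta) by near: n; exact: near1.
have left : Num.floor ((- (L.+1)%:Z)%:~R * finite_cf R a n)
    = Num.floor ((- (L.+1)%:Z)%:~R * theta) by near: n; exact: near1.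
move=> m; rewrite leq_eqVlt ltnS => /orP[/eqP mL|/inner//].
by have [->|->] : m = L.+1 \/ m = - (L.+1)%:Z by lia.
Unshelve. all: by end_near. Qed.

(** Exact agreement over a period covers m >= 0 only. A function supported around the origin also
    sees negative m, but in a fixed window, where convergence to the irrational theta suffices. *)
Lemma omega0_convergent_window (L : nat) : irrational theta ->
  \forall n \near \oo, forall m : int, (`|m| <= L)%N ->
    omega0 (finite_cf R a n) m = omega0 theta m.
Proof.
move=> irr; near=> n => m mL; rewrite !omega0E.
have win : forall k : int, (`|k| <= L + 2)%N ->
    Num.floor (k%:~R * finite_cf R a n) = Num.floor (k%:~R * theta).
  by near: n; exact: floor_convergent_window.
by rewrite !win//; lia.
Unshelve. all: by end_near. Qed.

End sturmian_coding.

(** * The trace map *)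

Section matrix2.
Variable C : comNzRingType.
Implicit Types A B : 'M[C]_2.

Lemma ord2_cases (i : 'I_2) : i = 0 \/ i = 1.
Proof. by case: i => [[|[|]]]//= lt; [left|right]; apply: val_inj. Qed.

Lemma eq_mx2 A B : A 0 0 = B 0 0 -> A 0 1 = B 0 1 -> A 1 0 = B 1 0 ->
  A 1 1 = B 1 1 -> A = B.
Proof.
move=> e00 e01 e10 e11; apply/matrixP => i j.
by have [->|->] := ord2_cases i; have [->|->] := ord2_cases j.
Qed.

Lemma eq_cV2 (x y : 'cV[C]_2) : x 0 0 = y 0 0 -> x 1 0 = y 1 0 -> x = y.
Proof.
move=> e0 e1; apply/matrixP => i j; rewrite ord1.
by have [->|->] := ord2_cases i.
Qed.

Lemma sum_ord2 (F : 'I_2 -> C) : \sum_i F i = F 0 + F 1.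
Proof. by rewrite !big_ord_recl big_ord0 addr0; congr (_ + F _); apply: val_inj. Qed.

Lemma mulmx2E m n (A : 'M[C]_(m, 2)) (B : 'M[C]_(2, n)) i j :
  (A *m B) i j = A i 0 * B 0 j + A i 1 * B 1 j.
Proof. by rewrite mxE sum_ord2. Qed.

Lemma mxtrace2 A : \tr A = A 0 0 + A 1 1.
Proof. by rewrite /mxtrace sum_ord2. Qed.

Lemma det_mx2 A : \det A = A 0 0 * A 1 1 - A 0 1 * A 1 0.
Proof.
rewrite (expand_det_row _ 0) sum_ord2 /cofactor !det_mx11 !mxE /= expr0 mul1r.
rewrite expr1 mulN1r mulrN; congr (_ * A _ _ - _ * A _ _); exact: val_inj.
Qed.

Lemma Cayley_Hamilton_mx2 A : A *m A = \tr A *: A - (\det A)%:M.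
Proof.
by apply: eq_mx2; rewrite !mxE !sum_ord2 mxtrace2 det_mx2 /=; ring.
Qed.

(** Cayley-Hamilton for [B] makes tr (A B^k) a linear recurrence of order two in k, which takes the
    place of Chebyshev polynomials in the trace map. *)
Lemma mxtrace_powSS A B k :
  \tr (A *m B ^+ k.+2) = \tr B * \tr (A *m B ^+ k.+1) - \det B * \tr (A *m B ^+ k).
Proof.
have -> : B ^+ k.+2 = \tr B *: B ^+ k.+1 - \det B *: B ^+ k.
  rewrite !exprS -!mulmxE mulmxA Cayley_Hamilton_mx2 mulmxBl -scalemxAl.
  by rewrite mul_scalar_mx.
by rewrite mulmxBr -!scalemxAr raddfB /= !mxtraceZ.
Qed.

End matrix2.

Section trace_recursion.
Variable R : realType.
Implicit Types x y u v : R[i].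

Lemma normcX x n : normc (x ^+ n) = normc x ^+ n.
Proof. by elim: n => [|n IH]; rewrite ?normc1// !exprS normcM IH. Qed.

Lemma normcB_ge x y : normc x - normc y <= normc (x - y).
Proof. by rewrite lerBlDr; apply: le_trans (le_normcD _ _); rewrite subrK. Qed.

Lemma normc_subC x y : normc (x - y) = normc (y - x).
Proof. by rewrite -normcN opprB. Qed.

Variables (X : nat -> 'M[R[i]]_2) (a : nat -> nat).
Hypothesis a_gt0 : forall j, (0 < j)%N -> (0 < a j)%N.

Definition trace_recursive :=
  forall n, X n.+2 = X n *m X n.+1 ^+ a n.+2.

(* A forward invariant region of the trace map on which the traces stay above 2
   in modulus (the full traces, not the half-traces [x_n], [y_n], [z_n]). *)
Definition escaped n :=
  [/\ 2 < normc (\tr (X n.+1)), 2 < normc (\tr (X n *m X n.+1)) &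
      normc (\tr (X n)) <= normc (\tr (X n *m X n.+1))].

Hypothesis Xrec : trace_recursive.

(** Interpolates between levels: k = 0 and k = a_(n+2) give the traces of [X n] and [X n.+2], while
    k = 1 and k = a_(n+2) + 1 give those of the products of neighbours. *)
Let t n k := \tr (X n *m X n.+1 ^+ k).

Let t0 n : t n 0%N = \tr (X n).
Proof. by rewrite /t expr0 mulmx1. Qed.

Let t1 n : t n 1%N = \tr (X n *m X n.+1).
Proof. by rewrite /t expr1. Qed.

Let t_end n : t n (a n.+2) = \tr (X n.+2).
Proof. by rewrite Xrec. Qed.

Let t_endS n : t n (a n.+2).+1 = \tr (X n.+1 *m X n.+2).
Proof. by rewrite mxtrace_mulC Xrec -mulmxA; congr (\tr (_ *m _)); rewrite exprSr. Qed.

Let tSS n k : t n k.+2 = \tr (X n.+1) * t n k.+1 - \det (X n.+1) * t n k.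
Proof. exact: mxtrace_powSS. Qed.

Section unimodular.
Hypothesis detX : forall n, normc (\det (X n)) = 1.

Let tSS_ge n k :
  normc (\tr (X n.+1)) * normc (t n k.+1) - normc (t n k) <= normc (t n k.+2).
Proof.
by rewrite tSS (le_trans _ (normcB_ge _ _))// !normcM detX mul1r.
Qed.

(** With y the trace of [X n.+1], |y| > 2 gives |t (k+2)| > 2 |t (k+1)| - |t k|, so |t k| does not
    decrease once it starts so. The strict inequality sharpens the weak one in [escaped]: after one
    step all conditions are open. *)
Lemma escaped_step n : escaped n ->
  escaped n.+1 /\ normc (\tr (X n.+1)) < normc (\tr (X n.+1 *m X n.+2)).
Proof.
case=> y2 z2 xz.
have grow k : 2 < normc (t n k.+1) /\ normc (t n k) <= normc (t n k.+1).
  elim: k => [|k [IH2 IH]]; first by rewrite t0 t1.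
  by have := tSS_ge n k; split; nra.
have := a_gt0 (ltn0Sn n.+1); case aE : (a n.+2) => [//|b] _.
(* Here |t (b+2)| >= (|y| - 1) |t (b+1)| > 2 (|y| - 1) > |y|. *)
have growy : normc (\tr (X n.+1)) < normc (t n b.+2).
  have [g2 g] := grow b; have := tSS_ge n b; nra.
rewrite -t_endS aE; split => //; split.
- by rewrite -t_end aE; case: (grow b).
- by rewrite -t_endS aE; case: (grow b.+1).
- by rewrite -t_endS aE ltW.
Qed.

Lemma escaped_trace n m : escaped n -> (n < m)%N -> 2 < normc (\tr (X m)).
Proof.
move=> esc nm; suff [//] : escaped m.-1 by rewrite prednK// (leq_ltn_trans _ nm).
elim: m nm => // m IH; rewrite ltnS leq_eqVlt => /orP[/eqP <- //|nm].
by have [] := escaped_step (IH nm); rewrite prednK// (leq_ltn_trans _ nm).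
Qed.

End unimodular.

Section bounded.
Hypothesis detX : forall n, \det (X n) = 1.

Let tSS1 n k : t n k.+2 = \tr (X n.+1) * t n k.+1 - t n k.
Proof. by rewrite tSS detX mul1r. Qed.

(* The Fricke-Vogt invariant of the trace map. *)
Let inv x y z := x ^+ 2 + y ^+ 2 + z ^+ 2 - x * y * z.

Let inv_t n k : inv (t n k) (\tr (X n.+1)) (t n k.+1)
  = inv (t n 0%N) (\tr (X n.+1)) (t n 1%N).
Proof. by elim: k => // k <-; rewrite tSS1 /inv; ring. Qed.

Let I := inv (t 0%N 0%N) (\tr (X 1%N)) (t 0%N 1%N).

Let inv_const n k : inv (t n k) (\tr (X n.+1)) (t n k.+1) = I.
Proof.
elim: n k => [|n IH] k; first exact: inv_t.
rewrite inv_t t0 t1 -(IH (a n.+2)) t_end t_endS /inv; ring.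
Qed.

Let inv_bound x y z (L : R) : normc x <= L -> normc y <= L ->
  normc z ^+ 2 <= L ^+ 2 * normc z + 2 * L ^+ 2 + normc (inv x y z).
Proof.
move=> xL yL.
have {1}-> : normc z ^+ 2 = normc (inv x y z + x * y * z + - (x ^+ 2) + - (y ^+ 2)).
  by rewrite -normcX; congr normc; rewrite /inv; ring.
have := le_normcD (inv x y z + x * y * z + - (x ^+ 2)) (- (y ^+ 2)).
have := le_normcD (inv x y z + x * y * z) (- (x ^+ 2)).
have := le_normcD (inv x y z) (x * y * z).
rewrite !normcN !normcX !normcM => h1 h2 h3.
have x0 := normc_ge0 x; have y0 := normc_ge0 y; have z0 := normc_ge0 z.
have xyL : normc x * normc y * normc z <= L ^+ 2 * normc z.
  by apply: ler_wpM2r => //; rewrite expr2 ler_pM.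
have xxL : normc x ^+ 2 <= L ^+ 2 by rewrite ler_sqr ?nnegrE// (le_trans x0).
have yyL : normc y ^+ 2 <= L ^+ 2 by rewrite ler_sqr ?nnegrE// (le_trans x0).
lra.
Qed.

Let quad_bound (z b c : R) : 0 <= z -> 0 <= b -> 0 <= c ->
  z ^+ 2 <= b * z + c -> z <= b + c + 1.
Proof. by move=> z0 b0 c0 h; rewrite leNgt; apply/negP => h1; nra. Qed.

(** The constant is 4 + 8 + 1: for L = 2 the quadratic inequality reads |z|^2 <= 4 |z| + 8 + |I|,
    with I the invariant. *)
Let inv_bound2 x y z : normc x <= 2 -> normc y <= 2 ->
  normc z <= 13 + normc (inv x y z).
Proof.
move=> x2 y2; have := inv_bound z x2 y2.
have := normc_ge0 (inv x y z); have := normc_ge0 z.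
move=> z0 i0 h; have := @quad_bound (normc z) 4 (8 + normc (inv x y z)) z0.
have -> : 4 + (8 + normc (inv x y z)) + 1 = 13 + normc (inv x y z) by ring.
by apply; lra.
Qed.

Let D n := Num.max (normc (\tr (X n))) (normc (\tr (X n.+1))).

Let t_convex n k : 2 < normc (\tr (X n.+1)) ->
  normc (t n k) <= Num.max (normc (t n 0%N)) (normc (t n k.+1)).
Proof.
move=> y2.
suff [h|h] : normc (t n k) <= normc (t n 0%N) \/ normc (t n k) <= normc (t n k.+1).
  by rewrite le_max h.
  by rewrite le_max h orbT.
elim: k => [|k IH]; first by left.
have [|h] := leP (normc (t n k.+1)) (normc (t n 0%N)); [by left | right].
have kS : normc (t n k) <= normc (t n k.+1).
  by case: IH => // /le_trans; apply; exact: ltW.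
have := normcB_ge (\tr (X n.+1) * t n k.+1) (t n k).
rewrite -tSS1 normcM; have := normc_ge0 (t n k.+1); nra.
Qed.

(* Unless the orbit escapes, the larger of two consecutive traces never exceeds
   [L]: with [y] the trace of [X n.+1], if [|y| <= 2] two of the next three
   coordinates have modulus at most 2 and the invariant bounds the third, and if
   [|y| > 2] the moduli [|t n k|] are convex in [k]. *)
Lemma not_escaped_bounded : (forall n, ~ escaped n) ->
  exists K : R, forall n, normc (\tr (X n)) <= K /\
    normc (\tr (X n *m X n.+1)) <= K.
Proof.
move=> nesc; pose L := Num.max (D 0%N) (13 + normc I).
have I0 := normc_ge0 I.
have DL n : D n <= L.
  elim: n => [|n IH]; first by rewrite /L le_max lexx.
  move: (IH); rewrite {1}/D ge_max => /andP[xL yL].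
  rewrite /D ge_max yL /=.
  have [y2|y2] := leP (normc (\tr (X n.+1))) 2.
    have [w2|w2] := leP (normc (\tr (X n.+2))) 2.
      by rewrite /L le_max; apply/orP; right; lra.
    have v2 : normc (t n (a n.+2).+1) <= 2.
      rewrite leNgt; apply/negP => v2; apply: (nesc n.+1); split => //.
        by rewrite -t_endS.
      by rewrite -t_endS; lra.
    have := inv_bound2 (t n (a n.+2)) y2 v2.
    rewrite t_end /L le_max => h; apply/orP; right; apply: le_trans h _.
    rewrite lerD2l le_eqVlt; apply/orP; left; apply/eqP; congr normc.
    by rewrite -(inv_const n (a n.+2)) t_end /inv; ring.
  have [w2|w2] := leP (normc (\tr (X n.+2))) 2; first by lra.
  have vy : normc (t n (a n.+2).+1) <= normc (\tr (X n.+1)).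
    rewrite leNgt; apply/negP => vy; apply: (nesc n.+1); split => //.
      by rewrite -t_endS; lra.
    by rewrite -t_endS; lra.
  have := t_convex (a n.+2) y2; rewrite t_end t0 => /le_trans; apply.
  by rewrite ge_max xL (le_trans vy).
have L0 : 0 <= L by rewrite /L le_max addr_ge0 ?orbT.
(* [L] bounds the single traces; the second summand is what the invariant then yields for the
   product. *)
exists (L + (L ^+ 2 + (2 * L ^+ 2 + normc I) + 1)) => n.
have := DL n; rewrite /D ge_max => /andP[xL yL].
have L2 := sqr_ge0 L; split; first by lra.
have := inv_bound (\tr (X n *m X n.+1)) xL yL.
have -> : inv (\tr (X n)) (\tr (X n.+1)) (\tr (X n *m X n.+1)) = I.
  by rewrite -(inv_const n 0%N) t0 t1.
rewrite -addrA => /(quad_bound (normc_ge0 _) L2).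
have I2 : 0 <= 2 * L ^+ 2 + normc I by lra.
by move=> /(_ I2); lra.
Qed.

End bounded.
End trace_recursion.

(** * Transfer matrices *)

Section disk_parameters.
Variable R : realType.
Implicit Types (x y z : R[i]) (a : disk R).

Lemma mul_conjc x : x * conjc x = real_complex R (normc x ^+ 2).
Proof.
case: x => x y; apply/eqP; rewrite eq_complex /= sqr_sqrtr ?addr_ge0 ?sqr_ge0//.
by apply/andP; split; apply/eqP; ring.
Qed.

Lemma normc_conj x : normc (conjc x) = normc x.
Proof. by case: x => x y /=; rewrite sqrrN. Qed.

Lemma conjcD x y : conjc (x + y) = conjc x + conjc y.
Proof. exact: rmorphD. Qed.

Lemma conjcM x y : conjc (x * y) = conjc x * conjc y.
Proof. exact: rmorphM. Qed.

Lemma conjcN x : conjc (- x) = - conjc x.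
Proof. exact: rmorphN. Qed.

Lemma disk_defect_gt0 x : normc x < 1 -> 0 < 1 - normc x ^+ 2.
Proof. by have := normc_ge0 x; move: (normc _) => t t0 t1; nra. Qed.

Lemma rho_sqr x : normc x < 1 -> rho x * rho x = 1 - x * conjc x.
Proof.
move=> x1; rewrite /rho -rmorphM -expr2 sqr_sqrtr ?ltW ?disk_defect_gt0//.
by rewrite rmorphB rmorph1 mul_conjc.
Qed.

Lemma rho_neq0 x : normc x < 1 -> rho x != 0.
Proof.
move=> x1; apply/eqP => r0; have := rho_sqr x1; rewrite r0 mul0r mul_conjc => /eqP.
rewrite -(rmorph1 (real_complex R)) -rmorphB eq_sym fmorph_eq0.
by rewrite gt_eqF// disk_defect_gt0.
Qed.

Lemma conj_rho x : conjc (rho x) = rho x.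
Proof. exact: conjc_real. Qed.

Lemma szego_det a z : \det (szego (val a) z) = z.
Proof.
case: a => x x1; rewrite det_mx2 !mxE /=.
have := rho_sqr x1; have := rho_neq0 x1.
move: (rho x) (conjc x) => r y r0 h.
have -> : r^-1 * z * (r^-1 * 1) - r^-1 * - y * (r^-1 * (- x * z))
  = (1 - x * y) * z / (r * r) by field; rewrite r0.
by rewrite -h; field; rewrite r0.
Qed.

End disk_parameters.

Section transfer_matrices.
Variable R : realType.
Implicit Types (al be : int -> disk R) (z r : R[i]).

Lemma transferS al z n :
  transfer al z n.+1 = szego (sval (al n)) z *m transfer al z n.
Proof. by []. Qed.

Lemma eq_transfer al be z n : (forall j : nat, (j < n)%N -> al j = be j) ->
  transfer al z n = transfer be z n.
Proof.
elim: n => // n IH ab; rewrite !transferS ab// IH// => j jn.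
by rewrite ab// ltnS ltnW.
Qed.

Lemma transferD al z m n :
  transfer al z (m + n) = transfer (fun j => al (j + m%:Z)) z n *m transfer al z m.
Proof.
elim: n => [|n IH]; first by rewrite addn0 mul1mx.
by rewrite addnS !transferS IH mulmxA PoszD addrC.
Qed.

Lemma transfer_det al z n : \det (transfer al z n) = z ^+ n.
Proof.
elim: n => [|n IH]; first by rewrite det1 expr0.
by rewrite transferS det_mulmx szego_det IH exprS.
Qed.

Lemma transfer_power al z (q k l : nat) :
  (forall j : nat, (j + q < k * q + l)%N -> al (j + q)%N = al j) ->
  transfer al z (k * q + l) = transfer al z l *m transfer al z q ^+ k.
Proof.
elim: k => [|k IH] per; first by rewrite mul0n add0n expr0 mulmx1.
rewrite mulSn -addnA transferD exprSr -mulmxE mulmxA; congr (_ *m _).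
rewrite -IH; last by move=> j jq; apply: per; lia.
by apply: eq_transfer => j jq; rewrite -PoszD per//; lia.
Qed.

Lemma Theta_sum_fun_pair p (be : int -> disk R) (f : int -> R[i]) (n : int) :
  odd `|n|%N == p ->
  Theta_sum_fun p be f n
    = conjc (val (be n)) * f n + rho (val (be n)) * f (n + 1) /\
  Theta_sum_fun p be f (n + 1)
    = rho (val (be n)) * f n - val (be n) * f (n + 1).
Proof.
move=> np; rewrite /Theta_sum_fun np; split; first by rewrite !mxE.
have -> : (odd (absz (n + 1)) == p) = false.
  by move/eqP: np => <-; apply/eqP; case: n => [n|[|n]] //=; lia.
by rewrite addrK !mxE /= mulNr.
Qed.

Section generalized_eigenfunctions.
Variables (al : int -> disk R) (z r : R[i]) (u : int -> R[i]).
Hypotheses (z0 : z != 0) (r2 : r ^+ 2 = z^-1).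

Definition mx_pair (x y : R[i]) : 'cV[R[i]]_2 := \col_i (if i == 0 then x else y).

Let v := Theta_sum_fun true al u.

(* With [v = M u], [E u = z u] says that [L v = z u]; the blocks [Theta] act in turn
   on [u] and on [v], so the entries of the state swap roles with the parity. *)
Definition gz_state (n : nat) : 'cV[R[i]]_2 :=
  if odd n then r *: mx_pair (v n) (z * u n) else mx_pair (u n) (v n).

Hypothesis eigen : forall n : nat, Theta_sum_fun false al v n = z * u n.

(** An even step solves a block of L and an odd step a block of M. The swapped entries and the
    factor [r] at odd sites bring both to the Szegő matrix times [r], since r^2 z = 1. *)
Lemma gz_state_step n : gz_state n.+1 = r *: (szego (val (al n)) z *m gz_state n).
Proof.
have nS : Posz n.+1 = n%:Z + 1 by lia.
rewrite /gz_state oddS nS; case: (boolP (odd n)) => on.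
  have := @Theta_sum_fun_pair true al u n (introT eqP on); rewrite -/v.
  case: (al n) => x x1 /= [-> ->].
  have rr := rho_sqr x1; have r0 := rho_neq0 x1.
  rewrite -scalemxAr scalerA -expr2 r2.
  apply: eq_cV2; rewrite !(mxE, sum_ord2) /=.
    by move: (rho x) (conjc x) r0 => rh c r0; field; rewrite r0 z0.
  move: (rho x) (conjc x) r0 rr => rh c r0 rr.
  have -> : z^-1 * (rh^-1 * (- x * z) * (c * u n + rh * u (n + 1)) + rh^-1 * 1 * (z * u n))
     = rh^-1 * ((1 - x * c) * u n) - x * u (n + 1) by field; rewrite r0 z0.
  by rewrite -rr; field; rewrite r0.
have := @Theta_sum_fun_pair false al v n (introT eqP (negbTE on)).
rewrite -nS !eigen nS; case: (al n) => x x1 /= [zu zu1].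
have rr := rho_sqr x1; have r0 := rho_neq0 x1.
rewrite zu1; congr (_ *: _); apply: eq_cV2; rewrite !(mxE, sum_ord2) /= ?mulrA.
  rewrite -[_ * z * u n]mulrA zu.
  by move: (rho x) (conjc x) r0 => rh c r0; field; rewrite r0.
rewrite -[_ * z * u n]mulrA zu; move: (rho x) (conjc x) r0 rr => rh c r0 rr.
have -> : rh^-1 * - x * (c * v n + rh * v (n + 1)) + rh^-1 * 1 * v n
     = rh^-1 * ((1 - x * c) * v n) - x * v (n + 1) by field; rewrite r0.
by rewrite -rr; field; rewrite r0.
Qed.

Lemma gz_stateE n : gz_state n = r ^+ n *: (transfer al z n *m gz_state 0).
Proof.
elim: n => [|n IH]; first by rewrite expr0 scale1r mul1mx.
by rewrite gz_state_step IH transferS -scalemxAr scalerA -exprS mulmxA.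
Qed.

Lemma normalized_transfer_det n : \det (r ^+ n *: transfer al z n) = 1.
Proof. by rewrite detZ transfer_det exprAC r2 -exprMn mulVf// expr1n. Qed.

(* Gordon's two-block argument: by Cayley-Hamilton the state at a square prefix
   of period [q] is recovered from the states at [q] and [2 q]. *)
Lemma gordon_two_block q :
  transfer al z (q + q) = transfer al z q *m transfer al z q ->
  gz_state 0 = \tr (r ^+ q *: transfer al z q) *: gz_state q - gz_state (q + q).
Proof.
move=> sq; rewrite (gz_stateE q) (gz_stateE (q + q)) sq exprD.
set N := r ^+ q *: transfer al z q.
have NN : (r ^+ q * r ^+ q) *: (transfer al z q *m transfer al z q *m gz_state 0)
    = N *m N *m gz_state 0.
  by rewrite /N -!(scalemxAl, scalemxAr) !scalerA.
rewrite NN scalemxAl -/N Cayley_Hamilton_mx2 /N normalized_transfer_det -/N.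
by rewrite mulmxBl mul1mx scalemxAl opprB addrC subrK.
Qed.

End generalized_eigenfunctions.
End transfer_matrices.

(** * The space l^2 and the resolvent of E *)

Section window_sums.
Variable R : realType.
Implicit Types (f g : int -> R[i]) (s : int).

(** Norm estimates are made on finite windows s <= n < s + m: each bounds the sum over Z from below,
    and the symmetric ones exhaust it. *)
Definition wsum f s (m : nat) : R := \sum_(i < m) normc (f (s + i%:Z)) ^+ 2.

Lemma wsum_ge0 f s m : 0 <= wsum f s m.
Proof. by apply: sumr_ge0 => i _; exact: sqr_ge0. Qed.

Lemma eq_wsum f g s m : (forall i, s <= i < s + m%:Z -> f i = g i) ->
  wsum f s m = wsum g s m.
Proof. by move=> fg; apply: eq_bigr => i _; rewrite fg//; have := ltn_ord i; lia. Qed.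

Lemma le_wsum f g s m :
  (forall i, s <= i < s + m%:Z -> normc (f i) <= normc (g i)) ->
  wsum f s m <= wsum g s m.
Proof.
move=> fg; apply: ler_sum => i _; rewrite ler_sqr ?nnegrE ?normc_ge0//.
by apply: fg; have := ltn_ord i; lia.
Qed.

Lemma wsumD f s m n : wsum f s (m + n) = wsum f s m + wsum f (s + m%:Z) n.
Proof.
rewrite /wsum big_split_ord/=; congr (_ + _).
by apply: eq_bigr => i _; rewrite PoszD addrA.
Qed.

Lemma wsumS f s m : wsum f s m.+1 = wsum f s m + normc (f (s + m%:Z)) ^+ 2.
Proof. by rewrite /wsum big_ord_recr. Qed.

Lemma wsum_subset f s m s' m' : s' <= s -> s + m%:Z <= s' + m'%:Z ->
  wsum f s m <= wsum f s' m'.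
Proof.
move=> ss' mm'; pose d := `|s - s'|%N.
have -> : m' = (d + (m + (m' - m - d)))%N by rewrite /d; lia.
have -> : s = s' + d by rewrite /d; lia.
by rewrite !wsumD; have := wsum_ge0 f s' d;
  have := wsum_ge0 f (s' + d%:Z + m%:Z) (m' - m - d); lra.
Qed.

Lemma wsumZ (c : R[i]) f s m :
  wsum (fun n => c * f n) s m = normc c ^+ 2 * wsum f s m.
Proof. by rewrite /wsum mulr_sumr; apply: eq_bigr => i _; rewrite normcM exprMn. Qed.

(* The weights [u] and [u^-1] are optimised in the triangle inequality. *)
Lemma wsum_add_le (u : R) f g s m : 0 < u ->
  wsum (fun n => f n + g n) s m <= (1 + u) * wsum f s m + (1 + u^-1) * wsum g s m.
Proof.
move=> u0; rewrite /wsum !mulr_sumr -big_split/=; apply: ler_sum => i _.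
have := le_normcD (f (s + i%:Z)) (g (s + i%:Z)).
have := normc_ge0 (f (s + i%:Z)); have := normc_ge0 (g (s + i%:Z)).
have := normc_ge0 (f (s + i%:Z) + g (s + i%:Z)).
move: (normc _) (normc _) (normc _) => x y t t0 y0 x0 txy.
have : t ^+ 2 <= (x + y) ^+ 2 by rewrite ler_sqr ?nnegrE ?addr_ge0//.
have : 0 <= u^-1 * (u * x - y) ^+ 2 by rewrite mulr_ge0 ?invr_ge0 ?sqr_ge0 ?ltW.
have -> : u^-1 * (u * x - y) ^+ 2 = u * x ^+ 2 - 2 * (x * y) + u^-1 * y ^+ 2.
  by field; rewrite gt_eqF.
nra.
Qed.

Let window s m : seq int := [seq s + i%:Z | i <- iota 0 m].

Let mem_window s m i : (i \in window s m) = (s <= i < s + m%:Z).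
Proof.
apply/mapP/idP => [[k] | /andP[si im]].
  by rewrite mem_iota => km ->; lia.
by exists `|i - s|%N; [rewrite mem_iota; lia | lia].
Qed.

Let uniq_window s m : uniq (window s m).
Proof.
have inj : injective (fun i : nat => s + i%:Z) by move=> i j; lia.
by rewrite (map_inj_uniq inj) iota_uniq.
Qed.

Let wsum_window f s m :
  ((wsum f s m)%:E = \sum_(i \in [set` window s m]) (normc (f i) ^+ 2)%:E)%E.
Proof.
rewrite -fsbig_seq ?uniq_window// big_map sumEFin /wsum.
by rewrite -(big_mkord xpredT (fun i => normc (f (s + i%:Z)) ^+ 2)) /index_iota subn0.
Qed.

Lemma wsum_le_esum f s m :
  ((wsum f s m)%:E <= \esum_(n in [set: int]) (normc (f n) ^+ 2)%:E)%E.
Proof.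
apply: esum_ge; exists [set` window s m]; last by rewrite wsum_window.
by split => //; exact: finite_seq.
Qed.

Lemma esum_le_wsum f (c : R) : (forall L : nat, wsum f (- L%:Z) (L + L) <= c) ->
  (\esum_(n in [set: int]) (normc (f n) ^+ 2)%:E <= c%:E)%E.
Proof.
move=> fc; apply: ge_ereal_sup => _ [X [finX _] <-].
have [r Xr] := (finite_seqP _).1 finX.
pose L := (\sum_(i <- r) `|i|%N).+1.
apply: (@le_trans _ _ (wsum f (- L%:Z) (L + L))%:E); last by rewrite lee_fin.
rewrite wsum_window; apply: lee_fsum_nneg_subset => //.
- exact: finite_seq.
- move=> i; rewrite !inE Xr /= mem_window => ir.
  suff : (`|i| <= \sum_(i <- r) `|i|)%N by rewrite /L; lia.
  by rewrite (big_rem i)//= leq_addr.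
- by move=> i _; rewrite lee_fin sqr_ge0.
Qed.

Lemma wsum_ell2 f (c : R) : (forall L : nat, wsum f (- L%:Z) (L + L) <= c) ->
  f \in ell2_pred R.
Proof. by move=> fc; apply/ell2P; rewrite (le_lt_trans (esum_le_wsum fc))// ltry. Qed.

End window_sums.

Section ell2_norm.
Variable R : realType.
Implicit Types (f g : ell2 R) (c : R).

Lemma ell2_eq f g : (forall n, f n = g n) -> f = g.
Proof. by move=> fg; apply/val_inj/funext. Qed.

Lemma ell2_addE f g n : (f + g) n = f n + g n. Proof. by []. Qed.

Lemma ell2_subE f g n : (f - g) n = f n - g n. Proof. by []. Qed.

Lemma ell2_oppE f n : (- f) n = - f n. Proof. by []. Qed.

Lemma ell2_scaleE (x : R[i]) f n : (x *: f) n = x * f n. Proof. by []. Qed.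

Lemma ell2_norm_ge0 f : 0 <= ell2_norm f.
Proof. exact: sqrtr_ge0. Qed.

Let esum_f_ge0 f : (0 <= \esum_(n in [set: int]) (normc (f n) ^+ 2)%:E)%E.
Proof. by apply: esum_ge0 => n _; rewrite lee_fin sqr_ge0. Qed.

Let ell2_norm_sqr f :
  ((ell2_norm f ^+ 2)%:E = \esum_(n in [set: int]) (normc (f n) ^+ 2)%:E)%E.
Proof.
rewrite /ell2_norm sqr_sqrtr ?fine_ge0// fineK// ge0_fin_numE//.
exact/ell2P/ell2_funP.
Qed.

Lemma wsum_le_norm f s m : wsum f s m <= ell2_norm f ^+ 2.
Proof. by rewrite -lee_fin ell2_norm_sqr wsum_le_esum. Qed.

Lemma ell2_norm_le f c : 0 <= c ->
  (forall L : nat, wsum f (- L%:Z) (L + L) <= c ^+ 2) -> ell2_norm f <= c.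
Proof.
move=> c0 fc; rewrite -ler_sqr ?nnegrE ?ell2_norm_ge0//.
by rewrite -lee_fin ell2_norm_sqr esum_le_wsum.
Qed.

Lemma normc_le_ell2_norm f n : normc (f n) <= ell2_norm f.
Proof.
rewrite -ler_sqr ?nnegrE ?normc_ge0 ?ell2_norm_ge0//.
by have := wsum_le_norm f n 1; rewrite /wsum big_ord1 addr0.
Qed.

Lemma ell2_norm_eq0 f : ell2_norm f <= 0 -> f = 0.
Proof.
move=> f0; apply/val_inj/funext => n; apply: eq0_normc.
by apply/eqP; rewrite eq_le normc_ge0 (le_trans (normc_le_ell2_norm f n)).
Qed.

Lemma ell2_norm0 : ell2_norm (0 : ell2 R) = 0.
Proof.
apply/eqP; rewrite eq_le ell2_norm_ge0 andbT; apply: ell2_norm_le => // L.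
by rewrite /wsum big1 ?expr0n// => i _; rewrite normc0 expr0n.
Qed.

Lemma le_ell2_normZ (x : R[i]) f : ell2_norm (x *: f) <= normc x * ell2_norm f.
Proof.
apply: ell2_norm_le => [|L]; first by rewrite mulr_ge0 ?normc_ge0 ?ell2_norm_ge0.
by rewrite [wsum _ _ _](wsumZ x f) exprMn ler_wpM2l ?sqr_ge0// wsum_le_norm.
Qed.

Lemma ell2_normN f : ell2_norm (- f) = ell2_norm f.
Proof.
suff le g : ell2_norm (- g) <= ell2_norm g.
  by apply/eqP; rewrite eq_le le -{1}[f]opprK le.
by have := le_ell2_normZ (-1) g; rewrite scaleN1r normcN normc1 mul1r.
Qed.

Lemma ell2_normD f g : ell2_norm (f + g) <= ell2_norm f + ell2_norm g.
Proof.
have [f0|f0] := leP (ell2_norm f) 0.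
  by rewrite (ell2_norm_eq0 f0) add0r lerDr ell2_norm_ge0.
have [g0|g0] := leP (ell2_norm g) 0.
  by rewrite (ell2_norm_eq0 g0) addr0 lerDl ell2_norm_ge0.
apply: ell2_norm_le => [|L]; first by rewrite addr_ge0 ?ltW.
(* With this weight the bound of [wsum_add_le] becomes exactly the square of the sum of the
   norms. *)
have u0 : 0 < ell2_norm g / ell2_norm f by exact: divr_gt0.
apply: le_trans (wsum_add_le f g _ _ u0) _.
have := wsum_le_norm f (- L%:Z) (L + L); have := wsum_le_norm g (- L%:Z) (L + L).
have -> : (ell2_norm f + ell2_norm g) ^+ 2
   = (1 + ell2_norm g / ell2_norm f) * ell2_norm f ^+ 2
   + (1 + (ell2_norm g / ell2_norm f)^-1) * ell2_norm g ^+ 2.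
  by field; rewrite !gt_eqF.
by move=> wg wf; apply: lerD; apply: ler_wpM2l => //; rewrite addr_ge0// ?invr_ge0 ltW.
Qed.

Lemma ell2_normB f g : ell2_norm (f - g) <= ell2_norm f + ell2_norm g.
Proof. by rewrite -(ell2_normN g) ell2_normD. Qed.

Lemma ell2_norm_triangle f g : ell2_norm f <= ell2_norm g + ell2_norm (f - g).
Proof. by rewrite -{1}(subrK g f) addrC ell2_normD. Qed.

Lemma trunc_ell2 f (L : nat) :
  (fun n => if (- L%:Z <= n < L%:Z) then f n else 0) \in ell2_pred R.
Proof.
apply: (@wsum_ell2 _ _ (ell2_norm f ^+ 2)) => M.
apply: le_trans (wsum_le_norm f (- M%:Z) (M + M)); apply: le_wsum => i _.
by case: ifP; rewrite // normc0 normc_ge0.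
Qed.

Definition trunc f L : ell2 R := Ell2 (trunc_ell2 f L).

Lemma trunc_near f c : 0 < c -> exists L0, forall L, (L0 <= L)%N ->
  ell2_norm (f - trunc f L) <= c.
Proof.
move=> c0.
have [L0 fL0] : exists L0 : nat,
    ell2_norm f ^+ 2 - c ^+ 2 <= wsum f (- L0%:Z) (L0 + L0).
  apply: contrapT => /forallNP nL0; pose d := ell2_norm f ^+ 2 - c ^+ 2.
  have lt_d L : wsum f (- L%:Z) (L + L) < d.
    by rewrite ltNge; apply/negP; exact: nL0.
  have d0 : 0 <= d by rewrite ltW// (le_lt_trans _ (lt_d 0%N))// wsum_ge0.
  have fd : ell2_norm f <= Num.sqrt d.
    by apply: ell2_norm_le => [|L]; rewrite ?sqrtr_ge0// sqr_sqrtr// ltW.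
  have : ell2_norm f ^+ 2 <= d.
    by rewrite -(sqr_sqrtr d0) ler_sqr ?nnegrE ?sqrtr_ge0 ?ell2_norm_ge0.
  have : 0 < c ^+ 2 by rewrite exprn_gt0.
  rewrite /d; lra.
exists L0 => L LL0; apply: ell2_norm_le => [|M]; first exact: ltW.
pose K := (M + L)%N; pose h := fun n => (f - trunc f L) n.
have hE n : h n = f n - (if - L%:Z <= n < L%:Z then f n else 0) by [].
have hK : wsum h (- M%:Z) (M + M) <= wsum h (- K%:Z) (K + K).
  by apply: wsum_subset; rewrite /K; lia.
have split3 (g : int -> R[i]) : wsum g (- K%:Z) (K + K)
    = wsum g (- K%:Z) M + wsum g (- L%:Z) (L + L) + wsum g L%:Z M.
  have -> : (K + K = M + ((L + L) + M))%N by rewrite /K; lia.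
  rewrite wsumD wsumD addrA.
  have -> : - K%:Z + M%:Z = - L%:Z by rewrite /K; lia.
  by have -> : - L%:Z + (L + L)%N%:Z = L%:Z by lia.
have h0 : wsum h (- L%:Z) (L + L) = 0.
  rewrite /wsum big1// => i _; rewrite hE ifT; last by have := ltn_ord i; lia.
  by rewrite subrr normc0 expr0n.
have hl : wsum h (- K%:Z) M = wsum f (- K%:Z) M.
  by apply: eq_wsum => i iM; rewrite hE ifF ?subr0//; rewrite /K in iM; lia.
have hr : wsum h L%:Z M = wsum f L%:Z M.
  by apply: eq_wsum => i iM; rewrite hE ifF ?subr0//; lia.
have fL : wsum f (- L0%:Z) (L0 + L0) <= wsum f (- L%:Z) (L + L).
  by apply: wsum_subset; lia.
apply: le_trans hK _; have := wsum_le_norm f (- K%:Z) (K + K).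
move: (split3 h) (split3 f); rewrite h0 hl hr; lra.
Qed.

Lemma ell2_decay f c : 0 < c ->
  exists N : nat, forall n : int, (N <= `|n|)%N -> normc (f n) <= c.
Proof.
move=> /(trunc_near f)[N fN]; exists N.+1 => n Nn.
apply: le_trans (fN N (leqnn N)); apply: le_trans (normc_le_ell2_norm _ n).
have -> : (f - trunc f N) n = f n - (if - N%:Z <= n < N%:Z then f n else 0) by [].
by rewrite ifF ?subr0//; lia.
Qed.

End ell2_norm.

Section Theta_sum_unitary.
Variables (R : realType) (p : bool).
Implicit Types (al : int -> disk R) (f g : int -> R[i]).

Let normc_sqr (x : R[i]) : real_complex R (normc x ^+ 2) = x * conjc x.
Proof. by rewrite mul_conjc. Qed.

(** Unitarity of one block in polarised form: l^2 uses only norms, but unitarity of the finite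
    periodic matrix is read off from inner products. *)
Lemma Theta_sum_pair_dot al f g n : odd `|n|%N == p ->
  Theta_sum_fun p al f n * conjc (Theta_sum_fun p al g n)
  + Theta_sum_fun p al f (n + 1) * conjc (Theta_sum_fun p al g (n + 1))
  = f n * conjc (g n) + f (n + 1) * conjc (g (n + 1)).
Proof.
move=> np; have [-> ->] := Theta_sum_fun_pair al f np.
have [-> ->] := Theta_sum_fun_pair al g np.
case: (al n) => x x1 /=; have rr := rho_sqr x1.
rewrite !(conjcD, conjcN, conjcM, conj_rho, conjcK).
move: (rho x) (conjc x) (conjc (g n)) (conjc (g (n + 1))) rr => r y gn gn1 rr.
transitivity ((r * r + x * y) * (f n * gn + f (n + 1) * gn1)); first by ring.
by rewrite rr subrK mul1r.
Qed.

Lemma Theta_sum_pair al f n : odd `|n|%N == p ->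
  normc (Theta_sum_fun p al f n) ^+ 2 + normc (Theta_sum_fun p al f (n + 1)) ^+ 2
  = normc (f n) ^+ 2 + normc (f (n + 1)) ^+ 2.
Proof.
move=> np; apply: (@complexI R); rewrite !rmorphD /= !normc_sqr.
exact: Theta_sum_pair_dot.
Qed.

Lemma wsum_Theta_sum al f s m : odd `|s|%N == p ->
  wsum (Theta_sum_fun p al f) s (m + m) = wsum f s (m + m).
Proof.
move=> sp; elim: m => [|m IH]; first by rewrite /wsum !big_ord0.
rewrite addSn addnS !wsumS IH -!addrA; congr (_ + _).
have -> : s + (m + m).+1%:Z = s + (m + m)%:Z + 1 by lia.
apply: Theta_sum_pair; move/eqP: sp => <-; apply/eqP.
lia.
Qed.

Lemma Theta_sum_norm_le al (f : ell2 R) :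
  ell2_norm (Theta_sum p al f) <= ell2_norm f.
Proof.
apply: ell2_norm_le => [|L]; first exact: ell2_norm_ge0.
(* Norms are conserved over windows made of whole blocks, so the window is enlarged to start at a
   site of parity [p]. *)
have [k [kL kp]] : exists k : nat, (L <= k)%N /\ odd k = p.
  exists (if odd L == p then L else L.+1).
  by case: eqP => // /eqP; case: (p); rewrite /=; case: odd.
apply: le_trans (wsum_le_norm f (- k%:Z) (k + k)).
rewrite -(@wsum_Theta_sum al f (- k%:Z)); last by rewrite abszN kp.
by apply: wsum_subset; lia.
Qed.

(* [Theta (conj a)] is the inverse of [Theta a]. *)
Definition conj_disk (a : disk R) : disk R :=
  exist _ (conjc (val a)) (etrans (congr1 (< 1) (normc_conj (val a))) (valP a)).

Lemma Theta_sum_conjK al (f : ell2 R) :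
  Theta_sum p (fun n => conj_disk (al n)) (Theta_sum p al f) = f.
Proof.
apply/val_inj/funext => n /=; set h := Theta_sum_fun p al f.
have key m : odd `|m|%N == p -> let g := Theta_sum_fun p (fun n => conj_disk (al n)) h in
    g m = f m /\ g (m + 1) = f (m + 1).
  move=> mp /=; have [-> ->] := Theta_sum_fun_pair (fun n => conj_disk (al n)) h mp.
  have := Theta_sum_fun_pair al f mp; rewrite -/h => -[-> ->] /=.
  case: (al m) => x x1 /=.
  have -> : rho (conjc x) = rho x by rewrite /rho normc_conj.
  rewrite conjcK; have := rho_sqr x1; move: (rho x) (conjc x) => r y rr; split.
    by transitivity ((r * r + x * y) * f m); [ring | rewrite rr subrK mul1r].
  by transitivity ((r * r + x * y) * f (m + 1)); [ring | rewrite rr subrK mul1r].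
have [np|np] := boolP (odd `|n|%N == p); first exact: (key n np).1.
have np1 : odd (absz (n - 1)) == p by case: (p) np; lia.
by have /= [_] := key _ np1; rewrite subrK.
Qed.

End Theta_sum_unitary.

Section geometric_completeness.
Variable R : realType.
Implicit Types (f g : ell2 R) (c : R).

Let ReD (x y : R[i]) : complex.Re (x + y) = complex.Re x + complex.Re y.
Proof. by case: x y => ? ? [? ?]. Qed.

Let ImD (x y : R[i]) : complex.Im (x + y) = complex.Im x + complex.Im y.
Proof. by case: x y => ? ? [? ?]. Qed.

Let normc2 (x : R[i]) : normc x ^+ 2 = complex.Re x ^+ 2 + complex.Im x ^+ 2.
Proof. by case: x => x y /=; rewrite sqr_sqrtr// addr_ge0 ?sqr_ge0. Qed.

Let Re_le (x : R[i]) : `|complex.Re x| <= normc x.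
Proof.
rewrite -ler_sqr ?nnegrE ?normc_ge0// normc2 real_normK ?num_real//.
by rewrite lerDl sqr_ge0.
Qed.

Let Im_le (x : R[i]) : `|complex.Im x| <= normc x.
Proof.
rewrite -ler_sqr ?nnegrE ?normc_ge0// normc2 real_normK ?num_real//.
by rewrite lerDr sqr_ge0.
Qed.

Variables (h : nat -> ell2 R) (C c : R).
Hypotheses (c0 : 0 <= c) (c1 : c < 1) (hC : forall k, ell2_norm (h k) <= C * c ^+ k).

Let s K := \sum_(k < K) h k.
Let d := C / (1 - c).

Let onec : 0 < 1 - c. Proof. by rewrite subr_gt0. Qed.

Let C0 : 0 <= C.
Proof. by have := le_trans (ell2_norm_ge0 _) (hC 0); rewrite expr0 mulr1. Qed.

Let d0 : 0 <= d. Proof. by rewrite divr_ge0// ltW. Qed.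

Let dc0 K : 0 <= d * c ^+ K. Proof. exact: mulr_ge0 d0 (exprn_ge0 K c0). Qed.

Let sS K : s K.+1 = s K + h K. Proof. exact: big_ord_recr. Qed.

Let s_tail K j : ell2_norm (s (K + j)%N - s K) <= d * c ^+ K.
Proof.
suff : ell2_norm (s (K + j)%N - s K) <= d * c ^+ K * (1 - c ^+ j).
  move=> /le_trans; apply; rewrite ler_piMr//.
  by rewrite gerBl exprn_ge0.
elim: j => [|j IH]; first by rewrite addn0 subrr ell2_norm0 expr0 subrr mulr0.
rewrite addnS sS addrAC; apply: le_trans (ell2_normD _ _) _.
have -> : d * c ^+ K * (1 - c ^+ j.+1)
    = d * c ^+ K * (1 - c ^+ j) + C * c ^+ (K + j).
  by rewrite /d exprD exprS; field; rewrite gt_eqF.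
exact: lerD.
Qed.

Let cvg_part (P : R[i] -> R) n : (forall x y, P (x + y) = P x + P y) ->
  P 0 = 0 -> (forall x, `|P x| <= normc x) ->
  cvgn (fun K => P (s K n)).
Proof.
move=> PD P0 Pn.
have -> : (fun K => P (s K n)) = series (fun k => P (h k n)).
  apply/funext => K; rewrite /series /=.
  elim: K => [|K IH]; first by rewrite big_nil /s big_ord0.
  by rewrite big_nat_recr//= -IH sS -PD.
apply: normed_cvg; apply: (@series_le_cvg _ _ (geometric C c)) => //.
- by move=> k; exact: normr_ge0.
- by move=> k; exact: mulr_ge0 C0 (exprn_ge0 k c0).
- move=> k; apply: le_trans (Pn _) _.
  by apply: le_trans (normc_le_ell2_norm _ _) _; exact: hC.
- by apply: is_cvg_geometric_series; rewrite ger0_norm.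
Qed.

Let F (n : int) : R[i] :=
  Complex (limn (fun K => complex.Re (s K n))) (limn (fun K => complex.Im (s K n))).

Let cvg_diff K n :
  (fun J => normc (s J n - s K n) ^+ 2) @ \oo --> normc (F n - s K n) ^+ 2.
Proof.
have cRe : (fun J => complex.Re (s J n)) @ \oo --> limn (fun J => complex.Re (s J n)).
  exact: cvg_part.
have cIm : (fun J => complex.Im (s J n)) @ \oo --> limn (fun J => complex.Im (s J n)).
  exact: cvg_part.
rewrite normc2.
have -> : (fun J => normc (s J n - s K n) ^+ 2) = (fun J =>
    (complex.Re (s J n) - complex.Re (s K n)) * (complex.Re (s J n) - complex.Re (s K n))
  + (complex.Im (s J n) - complex.Im (s K n)) * (complex.Im (s J n) - complex.Im (s K n))).
  by apply/funext => J; rewrite normc2 !expr2; case: (s J n) (s K n) => ? ? [? ?].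
have -> : complex.Re (F n - s K n) = limn (fun J => complex.Re (s J n)) - complex.Re (s K n).
  by rewrite /F; case: (s K n).
have -> : complex.Im (F n - s K n) = limn (fun J => complex.Im (s J n)) - complex.Im (s K n).
  by rewrite /F; case: (s K n).
rewrite !expr2; apply: cvgD; apply: cvgM; apply: cvgB => //; exact: cvg_cst.
Qed.

Let cvg_wsum K a m :
  (fun J => wsum (fun n => s J n - s K n) a m) @ \oo --> wsum (fun n => F n - s K n) a m.
Proof.
elim: m => [|m IH].
  by rewrite /wsum big_ord0; under eq_fun do rewrite big_ord0; exact: cvg_cst.
rewrite wsumS; under eq_fun do rewrite wsumS; exact: cvgD.
Qed.

Let wsum_tail K a m : wsum (fun n => F n - s K n) a m <= (d * c ^+ K) ^+ 2.
Proof.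
rewrite -(cvg_lim _ (@cvg_wsum K a m))//; apply: limr_le.
  by apply/cvg_ex; eexists; exact: cvg_wsum.
exists K => // J /= KJ.
apply: le_trans (wsum_le_norm (s J - s K) a m) _.
rewrite ler_sqr ?nnegrE ?ell2_norm_ge0//.
by rewrite -(subnKC KJ) s_tail.
Qed.

(** The form of completeness that Neumann series use. Real and imaginary parts of each coordinate
    converge absolutely, and the tail bound passes to the limit on each finite window, hence to the
    norm. *)
Lemma ell2_geometric_sum :
  exists f, forall K, ell2_norm (f - \sum_(k < K) h k) <= d * c ^+ K.
Proof.
have FP : F \in ell2_pred R.
  apply: (@wsum_ell2 _ _ ((d * c ^+ 0) ^+ 2)) => L.
  apply: le_trans (wsum_tail 0 (- L%:Z) (L + L)).
  by rewrite /s big_ord0; apply: le_wsum => i _; rewrite subr0.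
exists (Ell2 FP) => K; apply: ell2_norm_le => // L.
exact: wsum_tail.
Qed.

End geometric_completeness.

Section resolvent.
Variable R : realType.
Implicit Types (T A : {linear ell2 R -> ell2 R}) (f g : ell2 R).

Lemma not_spectrum T (z : R[i]) (c : R) : 0 < c ->
  (forall f, c * ell2_norm f <= ell2_norm (T f - z *: f)) ->
  (forall g, exists f, T f - z *: f = g) -> ~ spectrum T z.
Proof.
move=> c0 below surj; apply; pose S g := projT1 (cid (surj g)).
have SK g : T (S g) - z *: S g = g by rewrite /S; case: cid.
have inj f g : T f - z *: f = T g - z *: g -> f = g.
  move=> fg; apply: subr0_eq.
  apply: ell2_norm_eq0; rewrite -(ler_pM2l c0) mulr0 (le_trans (below _))//.
  have -> : T (f - g) - z *: (f - g) = T f - z *: f - (T g - z *: g).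
    by rewrite linearB; apply: ell2_eq => n; rewrite !(ell2_subE, ell2_scaleE); ring.
  by rewrite fg subrr ell2_norm0.
have linS : linear S.
  move=> x f g; apply: inj; rewrite SK linearP scalerDr opprD addrACA SK.
  by rewrite scalerA mulrC -scalerA -scalerBr SK.
pose S' : {linear ell2 R -> ell2 R} :=
  HB.pack S (GRing.isLinear.Build R[i] (ell2 R) (ell2 R) *:%R S linS).
exists S'; split => //= [|f]; last by apply: inj; rewrite SK.
exists c^-1 => f; rewrite mulrC ler_pdivlMr// mulrC.
by rewrite (le_trans (below _))// SK.
Qed.

Lemma Neumann_surjective A (c : R) : 0 <= c -> c < 1 ->
  (forall f, ell2_norm (A f) <= c * ell2_norm f) ->
  forall g, exists f, f - A f = g.
Proof.
move=> c0 c1 Ac g.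
have hC k : ell2_norm (iter k A g) <= ell2_norm g * c ^+ k.
  elim: k => [|k IH]; first by rewrite expr0 mulr1.
  by rewrite iterS (le_trans (Ac _))// exprS mulrCA ler_wpM2l.
have [f fK] := ell2_geometric_sum c0 c1 hC; exists f.
pose s K := \sum_(k < K) iter k A g.
have fsK K : ell2_norm (f - s K) <= ell2_norm g / (1 - c) * c ^+ K by exact: fK.
have As K : A (s K) = s K + iter K A g - g.
  have <- : s K.+1 = s K + iter K A g by rewrite /s big_ord_recr.
  by rewrite /s linear_sum big_ord_recl /= addrAC subrr add0r.
have small K : ell2_norm (f - A f - g) <= (ell2_norm g / (1 - c) * 2 + ell2_norm g) * c ^+ K.
  have -> : f - A f - g = (f - s K) - A (f - s K) - iter K A g.
    by rewrite linearB As; apply: ell2_eq => n; rewrite !(ell2_subE, ell2_addE); ring.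
  apply: le_trans (ell2_normB _ _) _; rewrite mulrDl; apply: lerD => //.
  apply: le_trans (ell2_normB _ _) _; rewrite mulrAC mulr_natr mulr2n; apply: lerD => //.
  apply: le_trans (Ac _) _; apply: le_trans (fsK K).
  exact: ler_piMl (ell2_norm_ge0 _) (ltW c1).
apply/eqP; rewrite -subr_eq0; apply/eqP/ell2_norm_eq0.
set D := _ + ell2_norm g in small.
have cv : (fun K => D * c ^+ K) @ \oo --> 0.
  by have := @cvg_geometric R D c; rewrite ger0_norm//; apply.
rewrite -(cvg_lim _ cv)//; apply: limr_ge; first by apply/cvg_ex; exists 0.
by near=> K; exact: small.
Unshelve. all: by end_near. Qed.

Lemma Neumann_surjective_scaled A (x : R[i]) (c : R) : 0 <= c -> c < 1 ->
  (forall f, normc x * ell2_norm (A f) <= c * ell2_norm f) ->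
  forall g, exists f, f - x *: A f = g.
Proof.
move=> c0 c1 Ac.
have linA : linear (fun f => x *: A f).
  by move=> y f g; rewrite linearP scalerDr !scalerA mulrC.
pose A' : {linear ell2 R -> ell2 R} :=
  HB.pack (fun f => x *: A f) (GRing.isLinear.Build R[i] (ell2 R) (ell2 R) *:%R _ linA).
apply: (@Neumann_surjective A' c) => // f.
exact: le_trans (le_ell2_normZ _ _) (Ac f).
Qed.

End resolvent.

Section CMV_resolvent.
Variables (R : realType) (al : int -> disk R).
Implicit Types (f g : ell2 R) (z : R[i]).

Let E := extended_CMV al.
Let cal n := conj_disk (al n).
Let Einv : {linear ell2 R -> ell2 R} := Theta_sum true cal \o Theta_sum false cal.

Lemma CMV_norm_le f : ell2_norm (E f) <= ell2_norm f.
Proof. exact: le_trans (Theta_sum_norm_le _ _ _) (Theta_sum_norm_le _ _ _). Qed.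

Let Einv_norm_le f : ell2_norm (Einv f) <= ell2_norm f.
Proof. exact: le_trans (Theta_sum_norm_le _ _ _) (Theta_sum_norm_le _ _ _). Qed.

Let EK f : Einv (E f) = f.
Proof. by rewrite /Einv /E /= !Theta_sum_conjK. Qed.

Let calK : (fun n => conj_disk (cal n)) = al.
Proof.
apply/funext => n; apply/val_inj; rewrite /= conjcK; reflexivity.
Qed.

Let EinvK f : E (Einv f) = f.
Proof. by rewrite /Einv /E /= -{1 2}calK !Theta_sum_conjK. Qed.

Let E_norm_ge f : ell2_norm f <= ell2_norm (E f).
Proof. by rewrite -{1}(EK f). Qed.

(** For |z| < 1, E - z = (1 - z E^-1) E; for |z| > 1, E - z = - z (1 - z^-1 E). The factor in
    parentheses is inverted by a Neumann series because E and E^-1 do not increase norms. *)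
Lemma CMV_not_spectrum_off_circle z : normc z != 1 -> ~ spectrum E z.
Proof.
have z0 := normc_ge0 z; rewrite neq_lt => /orP[z1|z1].
  apply: (@not_spectrum _ _ _ (1 - normc z)) => [|f|g]; first by rewrite subr_gt0.
    have := le_ell2_normZ z f; have := E_norm_ge f.
    have := ell2_norm_triangle (E f) (z *: f); lra.
  have [f fg] : exists f, f - z *: Einv f = g.
    by apply: (@Neumann_surjective_scaled _ Einv z (normc z)) => // f;
      rewrite ler_wpM2l.
  by exists (Einv f); rewrite EinvK.
have nz : z != 0 by apply: contraTneq z1 => ->; rewrite normc0 ltr10.
apply: (@not_spectrum _ _ _ (normc z - 1)) => [|f|g]; first by rewrite subr_gt0.
  have := CMV_norm_le f; have := ell2_norm_triangle (z *: f) (E f).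
  have -> : ell2_norm (z *: f - E f) = ell2_norm (E f - z *: f).
    by rewrite -ell2_normN opprB.
  have : normc z * ell2_norm f <= ell2_norm (z *: f).
    have := le_ell2_normZ z^-1 (z *: f); rewrite scalerA mulVf// scale1r normcV.
    by rewrite mulrC ler_pdivlMr ?(lt_trans ltr01)// mulrC.
  lra.
have [f fg] : exists f, f - z^-1 *: E f = - z^-1 *: g.
  apply: (@Neumann_surjective_scaled _ E z^-1 (normc z)^-1).
  - by rewrite invr_ge0.
  - by rewrite invf_lt1// (lt_trans ltr01).
  - by move=> f; rewrite normcV ler_wpM2l ?invr_ge0// CMV_norm_le.
exists f; have /(congr1 (fun h => - z *: h)) := fg.
rewrite scalerBr !scalerA mulrNN mulfV// scale1r => <-.
by rewrite mulNr mulfV// scaleN1r scaleNr opprK addrC.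
Qed.

(* [E - lambda z] is invertible for [lambda < 1], and the lower bound keeps its
   inverse small enough for [lambda] near [1] to reach [E - z]. *)
Lemma CMV_not_spectrum_of_lower_bound z (e : R) : normc z = 1 -> 0 < e ->
  (forall f, e * ell2_norm f <= ell2_norm (E f - z *: f)) -> ~ spectrum E z.
Proof.
move=> z1; wlog e1 : e / e <= 1 => [hw e0 below|e0 below].
  apply: (hw (Num.min e 1)) => [||f].
  - by rewrite ge_min lexx orbT.
  - by rewrite lt_min e0 ltr01.
  - apply: le_trans (below f); rewrite ler_wpM2r ?ell2_norm_ge0//.
    by rewrite ge_min lexx.
apply: (not_spectrum e0 below) => g.
(* At [mu] = (1 - e/4) z the lower bound is still 3 e / 4, so the inverse there has norm at most 4 /
   (3 e), and multiplied by |d| = e/4 this gives the ratio 1/3. *)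
pose d := real_complex R (e / 4) * z; pose mu := z - d.
have nreal (x : R) : 0 <= x -> normc (real_complex R x) = x.
  by move=> x0; rewrite /= expr0n addr0 sqrtr_sqr ger0_norm.
have nd : normc d = e / 4 by rewrite normcM z1 mulr1 nreal// divr_ge0// ltW.
have nmu : normc mu != 1.
  have -> : mu = real_complex R (1 - e / 4) * z.
    by rewrite /mu /d rmorphB rmorph1; ring.
  by rewrite normcM z1 mulr1 nreal; [rewrite lt_eqF//; lra | lra].
have [S [_ SK KS]] := contrapT (CMV_not_spectrum_off_circle nmu).
have S_le f : ell2_norm (S f) <= 4 / (3 * e) * ell2_norm f.
  have := below (S f); have := ell2_norm_triangle (E (S f) - z *: S f) (E (S f) - mu *: S f).
  have -> : E (S f) - z *: S f - (E (S f) - mu *: S f) = - (d *: S f).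
    by apply: ell2_eq => n; rewrite /mu !(ell2_subE, ell2_scaleE, ell2_oppE); ring.
  rewrite KS ell2_normN; have := le_ell2_normZ d (S f); rewrite nd => h1 h2 h3.
  rewrite mulrAC ler_pdivlMr ?mulr_gt0//; lra.
have [f fg] : exists f, f - d *: S f = g.
  apply: (@Neumann_surjective_scaled _ S d (3^-1)); [lra | lra | move=> f].
  rewrite nd; have := S_le f; rewrite -(ler_pM2l (_ : 0 < e / 4)) ?divr_gt0//.
  have -> : e / 4 * (4 / (3 * e) * ell2_norm f) = 3^-1 * ell2_norm f.
    by field; rewrite gt_eqF.
  by [].
exists (S f); rewrite -fg -[X in _ = X - _](KS f).
by apply: ell2_eq => n; rewrite /mu !(ell2_subE, ell2_scaleE); ring.
Qed.

End CMV_resolvent.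

(** * Bounded traces imply spectrum *)

Section gordon.
Variables (R : realType) (al : int -> disk R) (z r : R[i]) (f : ell2 R).
Hypotheses (z0 : z != 0) (r2 : r ^+ 2 = z^-1).

Let v := Theta_sum true al f.

(** Both [f] and [v] decay, so the states at q and 2 q are small while the trace stays bounded. The
    equation is required at sites n >= 0 only, so [f] may be a preimage of a delta function at a
    negative site. *)
Lemma gordon_vanish (K : R) :
  (forall n : nat, Theta_sum_fun false al v n = z * f n) ->
  (forall N : nat, exists2 q : nat, (N <= q)%N &
    normc (\tr (r ^+ q *: transfer al z q)) <= K /\
    transfer al z (q + q) = transfer al z q *m transfer al z q) ->
  f 0 = 0 /\ v 0 = 0.
Proof.
move=> eigen squares; pose W := gz_state al z r f.
suff W0 i : W 0%N i 0 = 0.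
  by have := W0 0; have := W0 1; rewrite /W /gz_state !mxE.
(* Covers both shapes of the state: f n and v n at even n, r v n and r z f n at odd n. *)
pose C := 1 + normc r * (1 + normc z).
have r0 := normc_ge0 r; have nz0 := normc_ge0 z.
have C0 : 0 < C by rewrite /C ltr_pwDl// mulr_ge0// addr_ge0.
have WC (n : nat) (e : R) : normc (f n) <= e -> normc (v n) <= e ->
    forall j, normc (W n j 0) <= C * e.
  move=> fe ve j; have e0 := le_trans (normc_ge0 _) fe.
  have re := mulr_ge0 r0 e0; have rze := mulr_ge0 (mulr_ge0 r0 nz0) e0.
  have rv : normc r * normc (v n) <= normc r * e by exact: ler_wpM2l.
  have rzf : normc r * (normc z * normc (f n)) <= normc r * normc z * e.
    by rewrite -mulrA; apply: ler_wpM2l => //; exact: ler_wpM2l.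
  rewrite /W /gz_state -/v /C; case: odd; rewrite !mxE; case: ifP => _;
    rewrite ?normcM; lra.
apply: eq0_normc; apply/eqP; rewrite eq_le normc_ge0 andbT leNgt; apply/negP => W0.
set x := normc _ in W0.
have [? _ [trK _]] := squares 0%N; have K0 := le_trans (normc_ge0 _) trK.
(* Chosen so that (K + 1) C e = x - e falls short of x. *)
pose e := x / ((K + 1) * C + 1).
have KC : 0 <= (K + 1) * C by apply: mulr_ge0; [rewrite addr_ge0 | exact: ltW].
have D0 : 0 < (K + 1) * C + 1 by lra.
have e0 : 0 < e by exact: divr_gt0.
have [N1 fN] := ell2_decay f e0; have [N2 vN] := ell2_decay v e0.
have [q Nq [trq sq]] := squares (N1 + N2)%N.
have subE (A B : 'cV[R[i]]_2) b : (b *: A - B) i 0 = b * A i 0 - B i 0.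
  by rewrite !mxE.
have Wi : W 0%N i 0 = _ :=
  etrans (congr1 (fun A : 'cV_2 => A i 0) (gordon_two_block z0 r2 eigen sq)) (subE _ _ _).
have q1 : (N1 <= q)%N := leq_trans (leq_addr _ _) Nq.
have q2 : (N2 <= q)%N := leq_trans (leq_addl _ _) Nq.
have Wq : normc (W q i 0) <= C * e by apply: WC; [exact: fN | exact: vN].
have Wqq : normc (W (q + q)%N i 0) <= C * e.
  apply: WC; [apply: fN | apply: vN]; rewrite /=; exact: leq_trans (leq_addl q q).
have : x <= K * (C * e) + C * e.
  rewrite /x Wi; apply: le_trans (le_normcD _ _) _.
  rewrite normcN normcM; apply: lerD => //.
  by apply: ler_pM; rewrite ?normc_ge0.
have -> : K * (C * e) + C * e = x - e by rewrite /e; field; rewrite gt_eqF.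
lra.
Qed.

End gordon.

Section delta.
Variable R : realType.

Lemma delta_ell2 (k : int) : (fun n : int => (n == k)%:R) \in ell2_pred R.
Proof.
apply: (@wsum_ell2 _ _ 1) => L; move: (L + L)%N => m.
(* The bound 1 alone is not inductive; the stronger claim records whether the window has already
   passed [k]. *)
suff : wsum (fun n : int => (n == k)%:R : R[i]) (- L%:Z) m
    <= ((k < - L%:Z + m%:Z)%R)%:R.
  by move=> /le_trans; apply; rewrite lern1; case: (_ < _).
elim: m => [|m IH]; first by rewrite /wsum big_ord0 ler0n.
rewrite wsumS; have [km|km] := eqVneq (- L%:Z + m%:Z) k.
  apply: le_trans (lerD IH (lexx _)) _; rewrite normc1 expr1n.
  rewrite ltNge -km lexx add0r (_ : _ < _ = true)//; lia.
rewrite normc0 expr0n addr0 (le_trans IH)// ler_nat.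
by case: (ltP k (_ + m%:Z)) => // h; rewrite (_ : k < _ = true)//; lia.
Qed.

Definition delta k : ell2 R := Ell2 (delta_ell2 k).

End delta.

Lemma eventually_small_le0 (R : realType) (g : int -> R[i]) (x : R) :
  (forall e : R, 0 < e -> exists2 n, normc (g n) <= e & x <= normc (g n) ^+ 2) ->
  x <= 0.
Proof.
move=> small; rewrite leNgt; apply/negP => x0.
have [|n gn xn] := small (Num.min 1 (x / 2)); first by rewrite lt_min ltr01 divr_gt0.
move: gn; rewrite le_min => /andP[g1 gx]; have := normc_ge0 (g n).
move: (normc (g n)) g1 gx xn => y; nra.
Qed.

Section no_resolvent.
Variables (R : realType) (al : int -> disk R) (z : R[i]).
Variables (f : ell2 R) (k : int).
Hypothesis Ef : extended_CMV al f - z *: f = delta R k.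
Hypotheses (k_1 : k < 0) (k_2 : - 3%:Z < k).

Let v := Theta_sum true al f.

Lemma defect_eq n : Theta_sum_fun false al v n = z * f n + (n == k)%:R.
Proof.
have /(congr1 (fun g : ell2 R => g n)) := Ef; rewrite ell2_subE ell2_scaleE.
by rewrite [delta R k n]/=  => <-; rewrite addrC subrK.
Qed.

(* Energy conservation in the blocks of [M] and [L] makes [F] monotone, in the
   direction given by [|z| <= 1] or [|z| >= 1], while it tends to [0]. *)
Let F (j : nat) := normc (f (- 2 - j.*2%:Z)) ^+ 2 - normc (v (- 2 - j.*2%:Z)) ^+ 2.

(** Equivalently, F j - F (j+1) = (|z|^2 - 1) (|f n|^2 + |f (n+1)|^2) with n = - 4 - 2 j, by the L
    block on n, n + 1 and the M block on n + 1, n + 2. *)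
Let F_step j : F j = normc z ^+ 2 * normc (f (- 2 - j.+1.*2%:Z)) ^+ 2
   - normc (v (- 2 - j.+1.*2%:Z)) ^+ 2
   + (normc z ^+ 2 - 1) * normc (f (- 2 - j.+1.*2%:Z + 1)) ^+ 2.
Proof.
rewrite /F; set n := - 2 - j.+1.*2%:Z.
have -> : - 2 - j.*2%:Z = n + 1 + 1 by rewrite /n doubleS; lia.
have n_even : odd `|n|%N == false by rewrite /n doubleS; lia.
have n1_odd : odd (absz (n + 1)) == true by rewrite /n doubleS; lia.
(* Both sites are at most -3, to the left of [k], so the homogeneous equation holds there. *)
have nk : (n == k) = false by rewrite /n doubleS; lia.
have n1k : (n + 1 == k) = false by rewrite /n doubleS; lia.
have := Theta_sum_pair al v n_even; rewrite !defect_eq nk n1k.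
rewrite !addr0 !normcM !exprMn => h1; have := Theta_sum_pair al f n1_odd.
rewrite -/v => h2; have : Theta_sum_fun true al f = v by [].
by move=> e; rewrite e in h2; lra.
Qed.

Let F_le0 : normc z <= 1 -> F 0%N <= 0.
Proof.
move=> z1; have Fmono j : F 0%N <= F j.
  elim: j => // j IH; apply: le_trans IH _; rewrite (F_step j) /F.
  have := sqr_ge0 (normc (f (- 2 - j.+1.*2%:Z))).
  have := sqr_ge0 (normc (f (- 2 - j.+1.*2%:Z + 1))).
  have : normc z ^+ 2 <= 1 by rewrite expr_le1 ?normc_ge0.
  by move: (normc z ^+ 2) (_ ^+ 2) (_ ^+ 2) (_ ^+ 2) => a b c d; nra.
apply: (@eventually_small_le0 _ f) => e e0; have [N fN] := ell2_decay f e0.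
exists (- 2 - N.*2%:Z); first by apply: fN; lia.
apply: le_trans (Fmono N) _; rewrite /F gerBl; exact: sqr_ge0.
Qed.

Let F_ge0 : 1 <= normc z -> 0 <= F 0%N.
Proof.
move=> z1; have Fmono j : F j <= F 0%N.
  elim: j => // j IH; apply: le_trans IH; rewrite (F_step j) /F.
  have := sqr_ge0 (normc (f (- 2 - j.+1.*2%:Z))).
  have := sqr_ge0 (normc (f (- 2 - j.+1.*2%:Z + 1))).
  have : 1 <= normc z ^+ 2 by rewrite exprn_ege1.
  by move: (normc z ^+ 2) (_ ^+ 2) (_ ^+ 2) (_ ^+ 2) => a b c d; nra.
rewrite -oppr_le0.
apply: (@eventually_small_le0 _ v) => e e0; have [N vN] := ell2_decay v e0.
exists (- 2 - N.*2%:Z); first by apply: vN; lia.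
apply: le_trans (_ : _ <= - F N) _; first by rewrite lerN2.
by rewrite /F opprB gerBl; exact: sqr_ge0.
Qed.

(** The M block on -1, 0 carries the zeros to f (-1) = v (-1) = 0. By the L block on -2, -1, k = -1
    gives v (-2) <> 0 and |z f (-2)| = |alpha (-2)| |v (-2)| < |v (-2)|, so F 0 < 0; k = -2 gives v
    (-2) = 0 and z f (-2) = -1, so F 0 > 0. *)
Lemma no_resolvent_false : f 0 = 0 -> v 0 = 0 ->
  (k = - 1 /\ 1 <= normc z) \/ (k = - 2 /\ normc z <= 1 /\ z != 0) -> False.
Proof.
move=> f0 v0 kz.
have v_1 := Theta_sum_fun_pair al f (n := - 1) (p := true) isT.
have := defect_eq (- 2); have := defect_eq (- 1).
have /= := Theta_sum_fun_pair al v (n := - 2) (p := false) isT.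
have -> : - 2 + 1 = - 1 :> int by [].
move=> [-> ->]; move: v_1; have -> : - 1 + 1 = 0 :> int by [].
have vE n : Theta_sum_fun true al f n = v n by [].
rewrite !vE.
rewrite f0 v0; case: (al (- 1)) (al (- 2)) => x x1 [y y1].
rewrite /= !vE => -[v1E e1].
have rx := rho_neq0 x1; have ry := rho_neq0 y1.
have f1 : f (- 1) = 0.
  by move/esym/eqP: e1; rewrite mulr0 subr0 mulf_eq0 (negbTE rx) => /eqP.
have v1 : v (- 1) = 0 by rewrite v1E f1 !mulr0 addr0.
rewrite f1 v1 !mulr0 addr0 subr0 add0r.
case: kz => [[-> z1]|[-> [z1 z0]]]; rewrite /= ?vE.
  move=> e2 e3; have := F_ge0 z1; rewrite /F /= subr0.
  have v2 : 0 < normc (v (- 2)).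
    rewrite lt_neqAle normc_ge0 andbT eq_sym; apply: contraTneq isT => /eq0_normc v2.
    by move/eqP: e2; rewrite v2 mulr0 eq_sym oner_eq0.
  have := congr1 (@normc R) e3; rewrite addr0 !normcM normc_conj => e4.
  rewrite subr_ge0 ler_sqr ?nnegrE ?normc_ge0// => vf.
  have : normc y * normc (v (- 2)) < normc (v (- 2)) by rewrite gtr_pMl.
  have : normc (f (- 2)) <= normc z * normc (f (- 2)).
    by rewrite ler_peMl ?normc_ge0.
  lra.
move=> e2 e3; have := F_le0 z1; rewrite /F /= subr0 ?vE.
have v2 : v (- 2) = 0.
  by move/eqP: e2; rewrite mulf_eq0 (negbTE ry) => /eqP.
rewrite v2 normc0 expr0n subr0 => f2.
have /eq0_normc f20 : normc (f (- 2)) = 0.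
  by apply/eqP; rewrite -sqrf_eq0 eq_le f2 sqr_ge0.
by move/eqP: e3; rewrite v2 f20 !mulr0 add0r eq_sym oner_eq0.
Qed.

End no_resolvent.

Section sturmian_transfer.
Variables (R : realType) (theta : R) (a : nat -> nat) (beta gamma : disk R).
Hypothesis a_cf : is_cf_expansion a theta.
Let a_gt0 := a_cf.1.
Let al := sturmian_alpha theta beta gamma.
Let q := cf_denom a.

Lemma sturmian_alpha_shift n (j : nat) : (j + 2 < q n.+1)%N ->
  al (j + q n)%N = al j.
Proof. by move=> jq; rewrite /al /sturmian_alpha PoszD (omega0_shift a_cf)//; lia. Qed.

(** Room for the two sites lost in [omega0_shift]. With all partial quotients 1 the denominators are
    1, 1, 2, 3, 5, so index 3 is the first at which a gap of 2 is certain. *)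
Lemma cf_denom_gap n : (2 < n)%N -> (q n + 2 <= q n.+1)%N.
Proof.
case: n => // n n2; rewrite /q cf_denomSS.
have := cf_denom_ge a_gt0 n; have := a_gt0 (ltn0Sn n.+1); nia.
Qed.

Lemma transfer_square z n : (2 < n)%N ->
  transfer al z (q n + q n) = transfer al z (q n) *m transfer al z (q n).
Proof.
move=> n2; have := cf_denom_gap n2 => gap.
have := @transfer_power R al z (q n) 2 0.
rewrite addn0 mul2n -addnn mul1mx expr2 -mulmxE; apply => j jq.
by apply: sturmian_alpha_shift; lia.
Qed.

Lemma transfer_recursive z n : (2 < n)%N ->
  transfer al z (q n.+2) = transfer al z (q n) *m transfer al z (q n.+1) ^+ a n.+2.
Proof.
move=> n2; have qn : (n.+1 <= q n.+1)%N := cf_denom_ge a_gt0 n.+1.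
rewrite {1}/q cf_denomSS -/q; apply: transfer_power => j jq.
by apply: sturmian_alpha_shift; rewrite {1}/q cf_denomSS -/q; lia.
Qed.

Lemma trace_bounded_spectrum (root : R[i] -> R[i]) z :
  (forall zeta : R[i], zeta != 0 -> root zeta ^+ 2 = zeta^-1) ->
  trace_bounded_set theta a beta gamma root z -> spectrum (extended_CMV al) z.
Proof.
move=> rootP [z0 [K trK]] [S [_ _ KS]].
have r2 := rootP _ z0.
have squares N : exists2 m : nat, (N <= m)%N &
    normc (\tr (root z ^+ m *: transfer al z m)) <= K /\
    transfer al z (m + m) = transfer al z m *m transfer al z m.
  exists (q (N + 3)); first by rewrite (leq_trans _ (cf_denom_ge a_gt0 _))// leq_addr.
  split; last by apply: transfer_square; lia.
  by have := trK (N + 3)%N; rewrite addnS; apply.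
pose zk : int := if 1 <= normc z then - 1 else - 2.
have zkE : (zk = - 1 /\ 1 <= normc z) \/ (zk = - 2 /\ normc z <= 1 /\ z != 0).
  by rewrite /zk; case: leP => [|/ltW]; [left | right].
have zk0 : zk < 0 by case: zkE => [[->]|[->]].
have zk3 : - 3%:Z < zk by case: zkE => [[->]|[->]].
have [f0 v0] : S (delta R zk) 0 = 0 /\ Theta_sum true al (S (delta R zk)) 0 = 0.
  apply: (gordon_vanish z0 r2 _ squares) => n.
  rewrite (defect_eq (KS _)) (_ : (n%:Z == zk) = false) ?addr0//.
  by apply/eqP => nzk; move: zk0; rewrite -nzk.
exact: (no_resolvent_false (KS (delta R zk)) zk0 zk3 f0 v0 zkE).
Qed.

End sturmian_transfer.

(** * Periodic approximants *)

Section periodic_sums.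
Variables (C : nmodType) (n : nat).

Definition dsum (H : int -> C) (s : int) (m : nat) := \sum_(i < m) H (s + i%:Z).

Lemma dsum_shift (H : int -> C) s : (forall j, H (j + n%:Z) = H j) ->
  dsum H (s + 1) n = dsum H s n.
Proof.
rewrite /dsum; case: n => [|m] per; first by rewrite !big_ord0.
rewrite big_ord_recr big_ord_recl /= addr0 addrC; congr (_ + _).
  by rewrite -(per s); congr H; lia.
by apply: eq_bigr => i _; congr H; rewrite /bump /=; lia.
Qed.

Lemma dsum_periodic (H : int -> C) (k : nat) : (forall j, H (j + n%:Z) = H j) ->
  dsum H (- k%:Z) n = dsum H 0 n.
Proof.
move=> per; elim: k => [|k <-]; first by rewrite oppr0.
by rewrite -(dsum_shift (- k.+1%:Z) per); congr dsum; lia.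
Qed.

End periodic_sums.

Section row_norm.
Variable R : realType.

Definition rnorm2 n (v : 'rV[R[i]]_n) : R := \sum_j normc (v 0 j) ^+ 2.

Lemma rnorm2E n (v : 'rV[R[i]]_n) :
  real_complex R (rnorm2 v) = (v *m (map_mx Num.conj v^T)) 0 0.
Proof.
rewrite /rnorm2 rmorph_sum mxE; apply: eq_bigr => j _.
by rewrite !mxE; exact: esym (mul_conjc _).
Qed.

Lemma rnorm2_unitary n (v : 'rV[R[i]]_n) (P : 'M[R[i]]_n) :
  P *m map_mx Num.conj P^T = 1%:M -> rnorm2 (v *m P) = rnorm2 v.
Proof.
move=> PP; apply: (@complexI R); rewrite !rnorm2E trmx_mul map_mxM.
by rewrite mulmxA -(mulmxA v) PP mulmx1.
Qed.

Lemma rnorm2Z n (x : R[i]) (v : 'rV[R[i]]_n) :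
  rnorm2 (x *: v) = normc x ^+ 2 * rnorm2 v.
Proof.
by rewrite /rnorm2 mulr_sumr; apply: eq_bigr => j _; rewrite mxE normcM exprMn.
Qed.

Lemma rnorm2_eq0 n (v : 'rV[R[i]]_n) : rnorm2 v = 0 -> v = 0.
Proof.
move=> /eqP; rewrite psumr_eq0 => [/allP v0|j _]; last exact: sqr_ge0.
apply/rowP => j; rewrite mxE; apply: eq0_normc; apply/eqP.
by have := v0 j (mem_index_enum _); rewrite sqrf_eq0.
Qed.

(* A unitary matrix is unitarily diagonalisable, so [U - z] expands norms at
   least by the distance from [z] to the eigenvalues. *)
Lemma unitary_lower_bound n (U : 'M[R[i]]_n) (z : R[i]) (e : R) :
  0 <= e -> U *m map_mx Num.conj U^T = 1%:M ->
  (forall d (v : 'rV[R[i]]_n), v != 0 -> v *m U = d *: v -> e <= normc (d - z)) ->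
  forall v : 'rV[R[i]]_n, e ^+ 2 * rnorm2 v <= rnorm2 (v *m U - z *: v).
Proof.
move=> e0 UU eig v.
have nU : U \is normalmx by apply/normalmxP; rewrite UU (mulmx1C UU).
have [P [D [Pu UE]]] : exists P D, P \is unitarymx /\ U = invmx P *m diag_mx D *m P.
  exists (spectralmx U), (spectral_diag U).
  by split; [exact: spectral_unitarymx | exact: orthomx_spectralP].
have PP : P *m map_mx Num.conj P^T = 1%:M by apply/unitarymxP.
have Punit := unitarymx_unit Pu.
have PPI : invmx P *m map_mx Num.conj (invmx P)^T = 1%:M.
  rewrite (invmx_unitary Pu); apply/unitarymxP; by rewrite trmxC_unitary.
have PU : P *m U = diag_mx D *m P by rewrite UE -(mulmxA (invmx P)) mulKVmx.
have De k : e <= normc (D 0 k - z).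
  apply: (eig _ (row k P)).
    apply/eqP => rk0; have := congr1 (row k) PP; rewrite row_mul rk0 mul0mx.
    by move/(congr1 (fun w : 'rV_n => w 0 k)); rewrite !mxE eqxx => /eqP;
      rewrite eq_sym oner_eq0.
  by rewrite -row_mul PU mul_diag_mx; apply/rowP => j; rewrite !mxE.
pose x := v *m invmx P.
have vx : v = x *m P by rewrite mulmxKV.
have -> : v *m U - z *: v = (x *m diag_mx D - z *: x) *m P.
  by rewrite vx -mulmxA PU mulmxBl -scalemxAl mulmxA.
rewrite rnorm2_unitary// vx rnorm2_unitary// /rnorm2 mulr_sumr.
apply: ler_sum => k _; rewrite mul_mx_diag !mxE.
rewrite -[X in X - _]mulrC -mulrBl normcM exprMn ler_wpM2r ?sqr_ge0//.
by rewrite ler_sqr ?nnegrE ?normc_ge0.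
Qed.

End row_norm.

Section Theta_sum_support.
Variables (R : realType) (p : bool).
Implicit Types (al be : int -> disk R) (f g : int -> R[i]).

Lemma Theta_sum_fun_eq al be f g (L : nat) :
  (forall j : int, (`|j| <= L.+1)%N -> al j = be j) ->
  (forall j : int, (L < `|j|)%N -> g j = 0) -> f =1 g ->
  Theta_sum_fun p al f =1 Theta_sum_fun p be g.
Proof.
move=> albe gL /funext -> j; rewrite /Theta_sum_fun; case: ifP => _.
  have [jL|jL] := leqP `|j| L.+1; first by rewrite albe.
  by rewrite !gL ?mulr0//; lia.
have [jL|jL] := leqP (absz (j - 1)) L.+1; first by rewrite albe.
by rewrite !gL ?mulr0//; lia.
Qed.

Lemma Theta_sum_fun_support al f (L : nat) (j : int) :
  (forall j : int, (L < `|j|)%N -> f j = 0) -> (L.+1 < `|j|)%N ->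
  Theta_sum_fun p al f j = 0.
Proof.
move=> fL jL; rewrite /Theta_sum_fun.
by case: ifP => _; rewrite !fL ?mulr0 ?addr0//; lia.
Qed.

Lemma Theta_sum_fun_local al f g (j : int) :
  (forall k, j - 1 <= k <= j + 1 -> f k = g k) ->
  Theta_sum_fun p al f j = Theta_sum_fun p al g j.
Proof.
move=> fg; rewrite /Theta_sum_fun.
by case: ifP => _; rewrite !fg//; lia.
Qed.

End Theta_sum_support.

Section periodic_CMV.
Variables (R : realType) (be : int -> disk R) (m : nat).
Let q := m.+1.
(** The period 2 q is even, so that the parity of a site is defined modulo n; the successor form
    makes [inord] available. *)
Let n := (m + q).+1.
Hypothesis be_per : forall j, be (j + q%:Z) = be j.

Let nE : n = (q + q)%N. Proof. by rewrite /n /q addSn. Qed.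

Let idx (j : int) : 'I_n := inord (absz (j %% n%:Z)%Z).

Let idxE j : (idx j)%:Z = (j %% n%:Z)%Z.
Proof.
have n0 : n%:Z != 0 by [].
have := modz_ge0 j n0; have := ltz_mod j n0.
by rewrite /idx; case: (_ %% _)%Z => // k kn _; rewrite inordK//; lia.
Qed.

Definition ext_row (v : 'rV[R[i]]_n) (j : int) : R[i] := v 0 (idx j).

Let periodic (T : Type) (H : int -> T) := forall j, H (j + n%:Z) = H j.

Let ext_per v : periodic (ext_row v).
Proof. by move=> j; rewrite /ext_row /idx modzDr. Qed.

Let per_idx T (H : int -> T) j : periodic H -> H (idx j) = H j.
Proof.
move=> per; rewrite idxE.
have shift (k : nat) i : H (i + (k * n)%N%:Z) = H i.
  by elim: k i => [|k IH] i; rewrite ?addr0// mulSn PoszD addrA IH per.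
have := divz_eq j n; set d := (j %/ n)%Z; set i := (j %% n)%Z => ->.
case: d => k; first by rewrite -PoszM addrC shift.
rewrite -{1}(shift k.+1 (_ * _ + _)); congr H.
by rewrite NegzE PoszM; lia.
Qed.

Let ext_row_nat v (i : 'I_n) : ext_row v i = v 0 i.
Proof.
rewrite /ext_row; congr (v 0 _); apply/val_inj/eqP; rewrite -eqz_nat idxE.
by rewrite modz_small// ltz_nat ltn_ord.
Qed.

Let be_pern : periodic be.
Proof. by move=> j; rewrite nE PoszD addrA !be_per. Qed.

Let Theta_per p (F : int -> R[i]) : periodic F -> periodic (Theta_sum_fun p be F).
Proof.
move=> perF j; rewrite /Theta_sum_fun.
have -> : odd (absz (j + n%:Z)) = odd `|j|%N by rewrite nE; lia.
rewrite [j + n%:Z + 1]addrAC [j + n%:Z - 1]addrAC.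
by rewrite !be_pern !perF.
Qed.

Definition CMV_fun (al : int -> disk R) (F : int -> R[i]) :=
  Theta_sum_fun false al (Theta_sum_fun true al F).

Let CMV_per (F : int -> R[i]) : periodic F -> periodic (CMV_fun be F).
Proof. by move=> perF; do 2! apply: Theta_per. Qed.

Definition CMV_row (v : 'rV[R[i]]_n) : 'rV[R[i]]_n := \row_i CMV_fun be (ext_row v) i.

Let ext_CMV_row v j : ext_row (CMV_row v) j = CMV_fun be (ext_row v) j.
Proof. by rewrite /ext_row mxE -/(ext_row _) per_idx//; exact/CMV_per/ext_per. Qed.

Let CMV_row_linear : linear CMV_row.
Proof.
move=> c u v; apply/rowP => i; rewrite !mxE.
have ThP p (F G H : int -> R[i]) : (forall j, H j = c * F j + G j) -> forall j,
    Theta_sum_fun p be H j = c * Theta_sum_fun p be F j + Theta_sum_fun p be G j.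
  by move=> HE j; rewrite /Theta_sum_fun !HE; case: ifP => _; ring.
by apply: (ThP) => ?; apply: (ThP) => ?; rewrite /ext_row !mxE.
Qed.

Let CMV_lin : {linear 'rV[R[i]]_n -> 'rV[R[i]]_n} :=
  HB.pack CMV_row (GRing.isLinear.Build R[i] 'rV[R[i]]_n 'rV[R[i]]_n *:%R _ CMV_row_linear).

Definition CMV_mx := lin1_mx CMV_lin.

Let CMV_mxE v : v *m CMV_mx = CMV_row v.
Proof. by rewrite mul_rV_lin1. Qed.

Let pdot (F G : int -> R[i]) j := F j * conjc (G j).

Let dsum_Theta p (F G : int -> R[i]) s : odd `|s|%N == p ->
  dsum (pdot (Theta_sum_fun p be F) (Theta_sum_fun p be G)) s n = dsum (pdot F G) s n.
Proof.
move=> sp; rewrite nE; elim: q => [|k IH]; first by rewrite /dsum !big_ord0.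
have dsumS (H : int -> R[i]) l : dsum H s l.+1 = dsum H s l + H (s + l%:Z).
  by rewrite /dsum big_ord_recr.
rewrite addSn addnS !dsumS IH -!addrA; congr (_ + _).
have -> : s + (k + k).+1%:Z = s + (k + k)%:Z + 1 by lia.
apply: Theta_sum_pair_dot; move/eqP: sp => <-; apply/eqP; lia.
Qed.

Let pdot_per F G : periodic F -> periodic G -> periodic (pdot F G).
Proof. by move=> pF pG j; rewrite /pdot pF pG. Qed.

Let CMV_row_dot (u v : 'rV[R[i]]_n) : u *m CMV_mx *m map_mx Num.conj (v *m CMV_mx)^T
  = u *m map_mx Num.conj v^T.
Proof.
have dotE (x y : 'rV[R[i]]_n) :
    x *m map_mx Num.conj y^T = (dsum (pdot (ext_row x) (ext_row y)) 0 n)%:M.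
  rewrite [LHS]mx11_scalar; congr (_%:M); rewrite mxE; apply: eq_bigr => j _.
  by rewrite !mxE add0r /pdot !ext_row_nat.
rewrite !CMV_mxE !dotE; congr (_%:M).
have pu := ext_per u; have pv := ext_per v.
have -> : dsum (pdot (ext_row (CMV_row u)) (ext_row (CMV_row v))) 0 n
    = dsum (pdot (CMV_fun be (ext_row u)) (CMV_fun be (ext_row v))) 0 n.
  by apply: eq_bigr => j _; rewrite /pdot !ext_CMV_row.
(* L preserves the sum over a period starting at 0, M over one starting at -1; periodicity
   identifies the two. *)
rewrite dsum_Theta// -(dsum_periodic 1) ?dsum_Theta ?(dsum_periodic 1)//.
  exact: pdot_per.
by apply: pdot_per; exact: Theta_per.
Qed.

Lemma CMV_mx_unitary : CMV_mx *m map_mx Num.conj CMV_mx^T = 1%:M.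
Proof.
apply/matrixP => i j.
have := CMV_row_dot (delta_mx 0 i) (delta_mx 0 j).
rewrite trmx_mul map_mxM mulmxA -(mulmxA _ CMV_mx) trmx_delta map_delta_mx -rowE -!colE.
move=> /(congr1 (fun A : 'M[R[i]]_1 => A 0 0)).
by rewrite !mxE eqxx /= eq_sym.
Qed.

Section eigenfunctions.
Variables (d : R[i]) (v : 'rV[R[i]]_n).
Hypotheses (v0 : v != 0) (vd : v *m CMV_mx = d *: v).

Lemma CMV_mx_eigenvalue_circle : normc d = 1.
Proof.
have := rnorm2_unitary v CMV_mx_unitary; rewrite vd rnorm2Z.
have nv0 : rnorm2 v != 0 by apply: contraNneq v0 => /rnorm2_eq0 ->.
rewrite -[RHS]mul1r => /(mulIf nv0) /eqP.
by rewrite sqrf_eq1 => /orP[/eqP//|/eqP dN]; have := normc_ge0 d; rewrite dN oppr_ge0 ler10.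
Qed.

(* The normalised transfer matrix [N] over one period satisfies [N^2 w = w] on
   the state [w] of an eigenfunction, which forces [(tr N)^2 = 4]. *)
Lemma CMV_mx_eigenvalue_trace : normc (\tr (transfer be d q)) = 2.
Proof.
have d1 := CMV_mx_eigenvalue_circle.
have d0 : d != 0 by apply: contra_eqN d1 => /eqP ->; rewrite normc0 eq_sym oner_eq0.
pose r := sqrtc d^-1; have r2 : r ^+ 2 = d^-1 by exact: sqr_sqrtc.
have r1 : normc r = 1.
  have := congr1 (@normc R) r2; rewrite normcX normcV d1 invr1 => /eqP.
  by rewrite sqrf_eq1 => /orP[/eqP//|/eqP dN]; have := normc_ge0 r; rewrite dN oppr_ge0 ler10.
have r0 : r != 0 by apply: contra_eqN r1 => /eqP ->; rewrite normc0 eq_sym oner_eq0.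
pose u := ext_row v.
have eigen j : Theta_sum_fun false be (Theta_sum_fun true be u) j = d * u j.
  by rewrite -/(CMV_fun be u j) -ext_CMV_row -CMV_mxE vd /ext_row mxE.
pose W := gz_state be d r u.
have WE k : W k = r ^+ k *: (transfer be d k *m W 0%N).
  exact: (gz_stateE d0 r2 (fun j => eigen j)).
have Wn : W (q + q)%N = W 0%N.
  have per0 (H : int -> R[i]) : periodic H -> H (q + q)%N = H 0%N.
    by move=> /(_ 0); rewrite add0r nE.
  by rewrite /W /gz_state oddD addbb /= (per0 u (ext_per v))
    (per0 (Theta_sum_fun true be u) (Theta_per true (ext_per v))).
have sq : transfer be d (q + q) = transfer be d q *m transfer be d q.
  have := @transfer_power R be d q 2 0.
  rewrite addn0 mul2n -addnn mul1mx expr2 -mulmxE; apply => j _.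
  by rewrite PoszD be_per.
have gordon := gordon_two_block d0 r2 (fun j => eigen j) sq.
rewrite -/(W 0%N) -/(W q) -/(W (q + q)%N) Wn in gordon.
set t := \tr _ in gordon.
have W2 : t *: W q = 2 *: W 0%N.
  by move/eqP: gordon; rewrite eq_sym subr_eq => /eqP ->; rewrite scaler_nat mulr2n.
have NE : (r ^+ q *: transfer be d q) *m W 0%N = W q by rewrite -scalemxAl -WE.
have NW : (r ^+ q *: transfer be d q) *m W q = W 0%N.
  rewrite -[RHS]Wn (WE q) (WE (q + q)%N) sq.
  by rewrite -!(scalemxAl, scalemxAr) scalerA -exprD mulmxA.
have W3 : t *: W 0%N = 2 *: W q.
  by rewrite -{1}NW scalemxAr W2 -scalemxAr NE.
have W4 : t ^+ 2 *: W 0%N = 4 *: W 0%N.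
  rewrite expr2 -scalerA W3 scalerA mulrC -scalerA W2 scalerA; congr (_ *: _); ring.
have W0 : W 0%N != 0.
  (* A vanishing initial state propagates to all later states, and these contain every value of the
     eigenfunction. *)
  apply: contraNneq v0 => W0; apply/eqP/rowP => j; rewrite mxE -ext_row_nat -/u.
  have := WE j; rewrite W0 mulmx0 scaler0 /W /gz_state.
  case: odd => /(congr1 (fun A : 'cV_2 => (A 0 0, A 1 0))); rewrite !mxE /= => -[].
    by move=> _ /eqP; rewrite !mulf_eq0 (negbTE r0) (negbTE d0) => /eqP.
  by [].
have t4 : t ^+ 2 = 4.
  apply/eqP; rewrite -subr_eq0.
  have /eqP := congr1 (fun A => A - 4 *: W 0%N) W4; rewrite subrr -scalerBl scaler_eq0.
  by rewrite (negbTE W0) orbF.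
have tE : normc t = normc (\tr (transfer be d q)).
  by rewrite /t mxtraceZ normcM normcX r1 expr1n mul1r.
have := congr1 (@normc R) t4; rewrite normcX tE => h.
have : normc (4 : R[i]) = 4 by rewrite normcMn normc1.
rewrite -h => h4; have /eqP := h4; rewrite -subr_eq0.
have -> : normc (\tr (transfer be d q)) ^+ 2 - 4 =
  (normc (\tr (transfer be d q)) - 2) * (normc (\tr (transfer be d q)) + 2) by ring.
rewrite mulf_eq0 => /orP[|]; first by rewrite subr_eq0 => /eqP.
by rewrite gt_eqF// ltr_wpDl ?normc_ge0.
Qed.

End eigenfunctions.

(* A function supported near [0] is periodised without overlap, and then [E] acts
   on it as the periodic matrix does. *)
Lemma periodic_lower_bound (al : int -> disk R) (z : R[i]) (e : R)
    (f : int -> R[i]) (L : nat) :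
  0 <= e ->
  (forall d, normc d = 1 -> normc (\tr (transfer be d q)) = 2 -> e <= normc (d - z)) ->
  (L + 3 <= q)%N -> (forall j : int, (L < `|j|)%N -> f j = 0) ->
  (forall j : int, (`|j| <= L + 3)%N -> al j = be j) ->
  e ^+ 2 * wsum f (- q%:Z) (q + q)
    <= wsum (fun j => CMV_fun al f j - z * f j) (- q%:Z) (q + q).
Proof.
move=> e0 tr2 Lq fL albe.
(* The second term places the negative half of the support at representatives between 0 and 2 q. *)
pose v : 'rV[R[i]]_n := \row_i (f i%:Z + f (i%:Z - n%:Z)).
(* E couples sites at distance at most 2, hence the margin 2 around the window. At its left end, j =
   - q - 2, the translate j + 2 q = q - 2 leaves the support because L + 3 <= q. *)
have extv j : - q%:Z - 2 <= j < q%:Z + 2 -> ext_row v j = f j.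
  move=> jq; rewrite /ext_row mxE idxE.
  have [j0|j0] := leP 0 j.
    rewrite modz_small; last by rewrite nE; lia.
    by rewrite (fL (j - _)) ?addr0// nE; lia.
  rewrite -modzDr modz_small; last by rewrite nE; lia.
  by rewrite addrK (fL (j + _)) ?add0r// nE; lia.
have albeE j : CMV_fun al f j = CMV_fun be f j.
  apply: (@Theta_sum_fun_eq R false al be _ _ L.+1) => [k kL|k kL|k].
  - by rewrite albe//; lia.
  - exact: Theta_sum_fun_support kL.
  - by apply: (@Theta_sum_fun_eq R true al be _ _ L) => // i iL; rewrite albe//; lia.
have loc j : - q%:Z <= j < q%:Z -> CMV_fun be (ext_row v) j = CMV_fun be f j.
  move=> jq; apply: Theta_sum_fun_local => k kj; apply: Theta_sum_fun_local => i ik.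
  by apply: extv; lia.
have wE (w : 'rV[R[i]]_n) : rnorm2 w = wsum (ext_row w) (- q%:Z) (q + q).
  pose H j := normc (ext_row w j) ^+ 2.
  have perH : periodic H by move=> j; rewrite /H (ext_per w).
  transitivity (dsum H (- q%:Z) n); last by rewrite nE.
  rewrite dsum_periodic//; apply: eq_bigr => j _.
  by rewrite /H add0r ext_row_nat.
have low := @unitary_lower_bound R n CMV_mx z e e0 CMV_mx_unitary _ v.
have {}low : e ^+ 2 * rnorm2 v <= rnorm2 (v *m CMV_mx - z *: v).
  apply: low => d w w0 wd; apply: tr2.
    exact: CMV_mx_eigenvalue_circle w0 wd.
  exact: CMV_mx_eigenvalue_trace w0 wd.
rewrite !wE in low; move: low.
have -> : wsum (ext_row v) (- q%:Z) (q + q) = wsum f (- q%:Z) (q + q).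
  by apply: eq_wsum => j jq; apply: extv; lia.
move=> /le_trans; apply; rewrite le_eqVlt; apply/orP; left; apply/eqP.
apply: eq_wsum => j jq; rewrite albeE -loc; last by lia.
rewrite CMV_mxE -ext_CMV_row -(extv j); last by lia.
by rewrite /ext_row !mxE.
Qed.

End periodic_CMV.

(** * Spectrum implies bounded traces *)

Section transfer_continuity.
Variables (R : realType) (z : R[i]).
Implicit Types F G : R[i] -> R[i].

Definition cont_at F := forall e : R, 0 < e ->
  exists2 d : R, 0 < d & forall x, normc (x - z) < d -> normc (F x - F z) < e.

Lemma cont_at_cst c : cont_at (fun=> c).
Proof. by move=> e e0; exists 1 => // x _; rewrite subrr normc0. Qed.

Lemma cont_at_id : cont_at id.
Proof. by move=> e e0; exists e. Qed.

Lemma cont_atD F G : cont_at F -> cont_at G ->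
  cont_at (fun x => F x + G x).
Proof.
move=> cF cG e e0; have e2 : 0 < e / 2 by rewrite divr_gt0.
have [d1 d10 hF] := cF _ e2; have [d2 d20 hG] := cG _ e2.
exists (Num.min d1 d2) => [|x]; first by rewrite lt_min d10.
rewrite lt_min => /andP[/hF h1 /hG h2].
have -> : F x + G x - (F z + G z) = (F x - F z) + (G x - G z) by ring.
by have := le_normcD (F x - F z) (G x - G z); lra.
Qed.

Lemma cont_atM F G : cont_at F -> cont_at G ->
  cont_at (fun x => F x * G x).
Proof.
move=> cF cG e e0; pose A := normc (F z) + normc (G z) + 1.
have F0 := normc_ge0 (F z); have G0 := normc_ge0 (G z).
have A1 : 1 <= A by rewrite /A; lra.
(* If both factors vary by less than u <= 1, the product varies by at most u A <= e / 3. *)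
pose u := Num.min 1 (e / (3 * A)).
have u0 : 0 < u by rewrite lt_min ltr01 divr_gt0// mulr_gt0//; lra.
have uA : u * (3 * A) <= e by rewrite -ler_pdivlMr ?ge_min ?lexx ?orbT//; lra.
have u1 : u <= 1 by rewrite ge_min lexx.
have [d1 d10 hF] := cF _ u0; have [d2 d20 hG] := cG _ u0.
exists (Num.min d1 d2) => [|x]; first by rewrite lt_min d10.
rewrite lt_min => /andP[/hF h1 /hG h2].
have -> : F x * G x - F z * G z = (F x - F z) * (G x - G z)
    + (F z * (G x - G z) + (F x - F z) * G z) by ring.
have p0 := normc_ge0 (F x - F z); have s0 := normc_ge0 (G x - G z).
apply: le_lt_trans (le_normcD _ _) _.
apply: le_lt_trans (lerD (lexx _) (le_normcD _ _)) _; rewrite !normcM.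
have ps : normc (F x - F z) * normc (G x - G z) <= u * 1.
  by apply: ler_pM => //; [exact: ltW | exact: le_trans (ltW h2) u1].
have bs : normc (F z) * normc (G x - G z) <= normc (F z) * u.
  by rewrite ler_wpM2l// ltW.
have pc : normc (F x - F z) * normc (G z) <= u * normc (G z).
  by rewrite ler_wpM2r// ltW.
have FGu : 0 <= (normc (F z) + normc (G z)) * u by rewrite mulr_ge0 ?addr_ge0// ltW.
by move: uA; rewrite /A; lra.
Qed.

Lemma cont_at_transfer (al : int -> disk R) n i j :
  cont_at (fun x => transfer al x n i j).
Proof.
elim: n i j => [|n IH] i j; first exact: cont_at_cst.
have -> : (fun x => transfer al x n.+1 i j) = (fun x =>
    szego (val (al n)) x i 0 * transfer al x n 0 j
  + szego (val (al n)) x i 1 * transfer al x n 1 j).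
  by apply/funext => x; rewrite transferS mulmx2E.
have cS k l : cont_at (fun x => szego (val (al n)) x k l).
  rewrite /szego; under [X in cont_at X]eq_fun do rewrite !mxE.
  apply: cont_atM; first exact: cont_at_cst.
  case: (k == 0); case: (l == 0); try exact: cont_at_cst.
    exact: cont_at_id.
  by apply: cont_atM; [exact: cont_at_cst | exact: cont_at_id].
by apply: cont_atD; apply: cont_atM.
Qed.

Lemma cont_at_gt F (c : R) : cont_at F -> c < normc (F z) ->
  exists2 d : R, 0 < d & forall x, normc (x - z) < d -> c < normc (F x).
Proof.
move=> cF Fc; have [|d d0 hd] := cF (normc (F z) - c); first by rewrite subr_gt0.
exists d => // x /hd; rewrite normc_subC.
have := normcB_ge (F z) (F z - F x); rewrite subKr; lra.
Qed.

Lemma cont_at_lt F G : cont_at F -> cont_at G ->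
  normc (F z) < normc (G z) ->
  exists2 d : R, 0 < d & forall x, normc (x - z) < d -> normc (F x) < normc (G x).
Proof.
move=> cF cG FG; pose e := (normc (G z) - normc (F z)) / 2.
have e0 : 0 < e by rewrite divr_gt0 ?subr_gt0.
have [d1 d10 hF] := cF _ e0; have [d2 d20 hG] := cG _ e0.
exists (Num.min d1 d2) => [|x]; first by rewrite lt_min d10.
rewrite lt_min => /andP[/hF h1 /hG]; rewrite normc_subC => h2.
have := normcB_ge (G z) (G z - G x); rewrite subKr.
have := le_normcD (F x - F z) (F z); rewrite subrK; rewrite /e in h1 h2; lra.
Qed.

End transfer_continuity.

Section sturmian_escape.
Variables (R : realType) (theta : R) (a : nat -> nat) (beta gamma : disk R).
Hypotheses (theta_irr : irrational theta) (a_cf : is_cf_expansion a theta).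
Let a_gt0 := a_cf.1.
Let al := sturmian_alpha theta beta gamma.
Let q := cf_denom a.

(* The recursion for the transfer matrices is available from index 3 on. *)
Definition tail_transfer (z : R[i]) (k : nat) := transfer al z (q (3 + k)).
Definition tail_quotient (k : nat) := a (3 + k).

Let tail_quotient_gt0 j : (0 < j)%N -> (0 < tail_quotient j)%N.
Proof. by move=> _; apply: a_gt0. Qed.

Let tail_transfer_recursive z : trace_recursive (tail_transfer z) tail_quotient.
Proof. by move=> k; rewrite /tail_transfer !addnS (transfer_recursive beta gamma a_cf). Qed.

Let tail_transfer_det z k : normc z = 1 -> normc (\det (tail_transfer z k)) = 1.
Proof. by move=> z1; rewrite transfer_det normcX z1 expr1n. Qed.

(** Escape is tested on unnormalised matrices, with determinant of modulus 1; the invariant needs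
    determinant 1. On the circle |r| = 1, so putting back the powers of [r] changes no modulus. *)
Lemma not_escaped_trace_map_bounded (root : R[i] -> R[i]) z :
  root z ^+ 2 = z^-1 -> normc z = 1 ->
  (forall n, ~ escaped (tail_transfer z) n) ->
  trace_map_bounded_set theta a beta gamma root z.
Proof.
move=> r2 z1 nesc; set r := root z in r2.
have z0 : z != 0 by apply: contra_eqN z1 => /eqP ->; rewrite normc0 eq_sym oner_eq0.
have r1 : normc r = 1.
  have := congr1 (@normc R) r2; rewrite normcX normcV z1 invr1 => /eqP.
  by rewrite pexpr_eq1 ?normc_ge0// => /eqP.
pose X k := r ^+ q (3 + k) *: tail_transfer z k.
have Xrec : trace_recursive X tail_quotient.
  move=> k; rewrite /X tail_transfer_recursive exprZn -scalemxAl -scalemxAr scalerA.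
  by rewrite -exprM -exprD !addnS /q cf_denomSS addnC mulnC.
have detX k : \det (X k) = 1 by exact: normalized_transfer_det.
have trX k : normc (\tr (X k)) = normc (\tr (tail_transfer z k)).
  by rewrite mxtraceZ normcM normcX r1 expr1n mul1r.
have trXX k : normc (\tr (X k *m X k.+1))
    = normc (\tr (tail_transfer z k *m tail_transfer z k.+1)).
  rewrite /X -scalemxAl -scalemxAr scalerA mxtraceZ !normcM !normcX r1 !expr1n.
  by rewrite !mul1r.
have nescX k : ~ escaped X k.
  by rewrite /escaped !trX !trXX; exact: nesc.
have [K XK] := not_escaped_bounded Xrec detX nescX.
have half (x : R[i]) : normc (2^-1 * x) <= normc x.
  rewrite normcM normcV (_ : normc 2 = 2); last by rewrite normcMn normc1.
  by have := normc_ge0 x; lra.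
split => //.
pose g n := normc (x_seq theta a beta gamma r z n)
  + normc (y_seq theta a beta gamma r z n) + normc (z_seq theta a beta gamma r z n).
have g0 n : 0 <= g n by rewrite !addr_ge0 ?normc_ge0.
(* [x_seq] looks back one index, so the recursion from 3 on controls the triples from 4 on; the four
   earlier ones are added to the bound. *)
have gK k : g (4 + k)%N <= K + K + K.
  have MX j : M_seq theta a beta gamma r z (3 + j)%N = X j by [].
  have -> : (4 + k)%N = (3 + k).+1 by [].
  rewrite /g /x_seq /y_seq /z_seq.
  have -> : (3 + k).+1%:Z - 1 = (3 + k)%N by lia.
  rewrite -[(3 + k).+1]addnS !MX mxtrace_mulC; have [h1 h2] := XK k; have [h3 _] := XK k.+1.
  by apply: lerD; [apply: lerD|]; exact: le_trans (half _) _.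
have [K' gK'] : exists K', forall n, g n <= K'.
  exists (K + K + K + \sum_(i < 4) g i) => n.
  have K0 := le_trans (g0 _) (gK 0%N).
  have s0 : 0 <= \sum_(i < 4) g i by apply: sumr_ge0.
  have [n4|n4] := ltnP n 4; last by rewrite -(subnKC n4) (le_trans (gK _))// lerDl.
  rewrite (bigD1 (Ordinal n4))//= addrCA lerDl addr_ge0//.
  by apply: sumr_ge0.
exists K' => n; have := gK' n; rewrite /g.
have := normc_ge0 (x_seq theta a beta gamma r z n).
have := normc_ge0 (y_seq theta a beta gamma r z n).
have := normc_ge0 (z_seq theta a beta gamma r z n).
by split; lra.
Qed.

(** Three strict inequalities at index n + 1 persist near [z] by continuity, and forward invariance
    then works at each [x] separately, so one radius serves all later m. *)
Lemma escaped_open z n : normc z = 1 -> escaped (tail_transfer z) n ->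
  exists2 d : R, 0 < d & forall x m, normc x = 1 -> normc (x - z) < d -> (n.+1 < m)%N ->
    2 < normc (\tr (tail_transfer x m)).
Proof.
move=> z1 /(escaped_step tail_quotient_gt0 (tail_transfer_recursive z)
  (fun k => tail_transfer_det k z1))[[e1 e2 _] e3].
have ctr k : cont_at z (fun x => \tr (tail_transfer x k)).
  under [X in cont_at _ X]eq_fun do rewrite mxtrace2.
  by apply: cont_atD; exact: cont_at_transfer.
have ctr2 k : cont_at z (fun x => \tr (tail_transfer x k *m tail_transfer x k.+1)).
  under [X in cont_at _ X]eq_fun do rewrite mxtrace2 !mulmx2E.
  by apply: cont_atD; apply: cont_atD; apply: cont_atM;
    exact: cont_at_transfer.
have [d1 d10 h1] := cont_at_gt (ctr n.+2) e1.
have [d2 d20 h2] := cont_at_gt (ctr2 n.+1) e2.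
have [d3 d30 h3] := cont_at_lt (ctr n.+1) (ctr2 n.+1) e3.
exists (Num.min d1 (Num.min d2 d3)) => [|x m x1]; first by rewrite !lt_min d10 d20.
rewrite !lt_min => /andP[/h1 l1 /andP[/h2 l2 /h3 l3]].
apply: (escaped_trace tail_quotient_gt0 (tail_transfer_recursive x)
  (fun k => tail_transfer_det k x1)).
by split; [exact: l1 | exact: l2 | exact: ltW].
Qed.

Lemma escaped_lower_bound z n : normc z = 1 -> escaped (tail_transfer z) n ->
  exists2 d : R, 0 < d & forall f,
    d * ell2_norm f <= ell2_norm (extended_CMV al f - z *: f).
Proof.
move=> z1 /(escaped_open z1)[d d0 tr2]; exists d => // f.
set E := extended_CMV al.
have bound (L : nat) (g : ell2 R) : (forall j : int, (L < `|j|)%N -> g j = 0) ->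
    d * ell2_norm g <= ell2_norm (E g - z *: g).
  move=> gL; rewrite mulrC -ler_pdivlMr//; apply: ell2_norm_le => [|M].
    by rewrite divr_ge0 ?ell2_norm_ge0// ltW.
  (* [q N] has to exceed the support radius [L] and the norm window [M], and N - 3 the escape index;
     8 is ample room for the small shifts. *)
  have [N [evN NL win]] : exists N, [/\ ~~ odd N, (L + M + n + 8 <= N)%N &
      forall m : int, (`|m| <= L + 3)%N -> omega0 (finite_cf R a N) m = omega0 theta m].
    have [N0 _ winN0] := omega0_convergent_window a_cf (L + 3) theta_irr.
    exists (N0 + (L + M + n + 8)).*2; split; first by rewrite odd_double.
      by rewrite -addnn; lia.
    by apply: winN0 => /=; rewrite -addnn; lia.
  pose be := sturmian_alpha (finite_cf R a N) beta gamma.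
  pose m := (q N).-1; have mE : m.+1 = q N by rewrite prednK// cf_denom_gt0.
  have qN : (N <= m.+1)%N by rewrite mE; exact: cf_denom_ge.
  have per j : be (j + m.+1%:Z) = be j.
    by rewrite mE /be /sturmian_alpha (omega0_convergent_periodic a_cf).
  (* Sites j < q_N lie within the range q_N + q_(N+1) of exact agreement, so the trace over one
     period of the approximant is one of the Sturmian traces. *)
  have trbe x : transfer be x m.+1 = tail_transfer x (N - 3).
    rewrite /tail_transfer subnKC; last by lia.
    rewrite mE; apply: eq_transfer => j jq; rewrite /be /al /sturmian_alpha.
    rewrite (omega0_even_convergent a_cf)//.
    have := cf_denom_ge a_gt0 N.+1; rewrite -/q; lia.
  have low : d ^+ 2 * wsum g (- m.+1%:Z) (m.+1 + m.+1)
      <= wsum (fun j => CMV_fun al g j - z * g j) (- m.+1%:Z) (m.+1 + m.+1).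
    apply: (periodic_lower_bound per (L := L)) => //.
    - exact: ltW.
    - move=> x x1 trx; rewrite leNgt; apply/negP => xz.
      have := tr2 x (N - 3)%N x1 xz; rewrite -trbe trx ltxx => h.
      by suff : false by []; apply: h; lia.
    - by lia.
    - by move=> j jL; rewrite /al /be /sturmian_alpha win.
  rewrite expr_div_n ler_pdivlMr ?exprn_gt0// mulrC.
  apply: le_trans (wsum_le_norm (E g - z *: g) (- m.+1%:Z) (m.+1 + m.+1)).
  apply: le_trans low; rewrite ler_wpM2l ?sqr_ge0//.
  by apply: wsum_subset; lia.
apply/ler_addgt0Pr => e e0.
(* Truncation costs d |f - g| on the left and 2 |f - g| on the right, as E - z has norm at most 2;
   hence the factor d + 2. *)
have c0 : 0 < e / (d + 2) by rewrite divr_gt0// addr_gt0.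
have [L fL] := trunc_near f c0; have {}fL := fL L (leqnn L).
have := bound L (trunc f L) _; set g := trunc f L in fL *.
have g0 j : (L < `|j|)%N -> g j = 0 by move=> jL; rewrite /g /= ifF//; lia.
move=> /(_ g0) low.
have fg := ell2_norm_triangle f g.
have Efg : ell2_norm (E g - z *: g) <= ell2_norm (E f - z *: f) + 2 * ell2_norm (f - g).
  have -> : E g - z *: g = (E f - z *: f) - (E (f - g) - z *: (f - g)).
    have -> : E (f - g) = E f - E g by exact: linearB.
    move: (E f) (E g) (g : ell2 R) => u w h; apply: ell2_eq => j.
    by rewrite !(ell2_subE, ell2_scaleE); ring.
  apply: le_trans (ell2_normB _ _) _; apply: lerD => //.
  apply: le_trans (ell2_normB _ _) _; have := CMV_norm_le al (f - g).
  have := le_ell2_normZ z (f - g); rewrite z1 -/E; lra.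
have : ell2_norm (f - g) * (d + 2) <= e by rewrite -ler_pdivlMr// addr_gt0.
have : d * ell2_norm f <= d * (ell2_norm g + ell2_norm (f - g)) by rewrite ler_pM2l.
lra.
Qed.

Lemma spectrum_trace_map_bounded (root : R[i] -> R[i]) z :
  (forall zeta : R[i], zeta != 0 -> root zeta ^+ 2 = zeta^-1) ->
  spectrum (extended_CMV al) z -> trace_map_bounded_set theta a beta gamma root z.
Proof.
move=> rootP zS.
have z1 : normc z = 1.
  by apply: contrapT => /eqP zn1; exact: (CMV_not_spectrum_off_circle zn1 zS).
have z0 : z != 0 by apply: contra_eqN z1 => /eqP ->; rewrite normc0 eq_sym oner_eq0.
apply: not_escaped_trace_map_bounded => // [|n esc]; first exact: rootP.
have [d d0 low] := escaped_lower_bound z1 esc.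
exact: (CMV_not_spectrum_of_lower_bound z1 d0 low zS).
Qed.

End sturmian_escape.

Lemma trace_map_bounded_trace_bounded (R : realType) (theta : R) (a : nat -> nat)
    (beta gamma : disk R) (root : R[i] -> R[i]) :
  trace_map_bounded_set theta a beta gamma root
    `<=` trace_bounded_set theta a beta gamma root.
Proof.
move=> z [z0 [K bK]]; split=> //; exists (2 * K) => n n1.
have double (x : R[i]) : normc (2^-1 * x) <= K -> normc x <= 2 * K.
  rewrite normcM normcV (_ : normc 2 = 2); last by rewrite normcMn normc1.
  lra.
(* [y_seq] covers the indices n >= 0, and [x_seq] at 0 the index -1. *)
apply: double; case: n n1 => [n|[|n]] // _; first by have [] := bK n.
by have [] := bK 0%N.
Qed.

Theorem theorem3p2 (R : realType) (beta gamma : disk R) (theta : R)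
    (a : nat -> nat) (root : R[i] -> R[i]) :
  beta <> gamma ->
  0 < theta < 1 -> irrational theta ->
  is_cf_expansion a theta ->
  (forall zeta : R[i], zeta != 0 -> root zeta ^+ 2 = zeta^-1) ->
  let Sigma := spectrum (extended_CMV (sturmian_alpha theta beta gamma)) in
  let B := trace_bounded_set theta a beta gamma root in
  let B' := trace_map_bounded_set theta a beta gamma root in
  B' = Sigma /\ Sigma = B.
Proof.
move=> _ _ theta_irr a_cf rootP /=.
set S := spectrum _; set B := trace_bounded_set _ _ _ _ _.
set B' := trace_map_bounded_set _ _ _ _ _.
have B'B : B' `<=` B := @trace_map_bounded_trace_bounded _ _ _ _ _ _.
have BS : B `<=` S by move=> z; exact: trace_bounded_spectrum.
have SB' : S `<=` B' by move=> z; exact: spectrum_trace_map_bounded.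
by split; apply/seteqP; split=> z; [move/B'B/BS | move/SB' | move/SB'/B'B | move/BS].
Qed.
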